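(* Let $\{(X_i,\mathbf{P}_i)\}_{1\le i\le m}$ be finite probability spaces. For $t\in\{1,\ldots,k\}$ (with $k\ge1$) let $1\le q_t<r_t\le\infty$, $i_t,j_t\in\{1,\ldots,m\}$ and $f_t : X_{i_t}\times X_{j_t}\to\mathbf{C}$, and let $\varepsilon\in(0,1)$. Set $q := \max_t q_t$, $r := q\min_t (r_t/q_t)$, and $$\alpha(q,r) := \frac{2^{\max(\lceil\log_2 q\rceil,1)}}{1-\frac{q}{r}}$$ (with $q/r := 0$ when $r=\infty$, so $\alpha(q,\infty) = 2^{\max(\lceil\log_2 q\rceil,1)}$). Then: (a) there exist partitions $\mathcal{P}_i$ of $X_i$ ($1\le i\le m$) such that $$\max_i \log|\mathcal{P}_i| \ll_{k,q} \frac{1}{\varepsilon^{\alpha(q,\infty)}},\qquad \max_t\left\|f_t-\mathbf{E}(f_t\mid\mathcal{P}_{i_t}\otimes\mathcal{P}_{j_t})\right\|_\square\le\varepsilon\max_t\|f_t\|_{S^{q_t}};$$ (b) there exist partitions $\mathcal{P}'_i$ of $X_i$ ($1\le i\le m$) such that $$\max_i \mathbf{H}(\mathcal{P}'_i) \ll_{k,q,r} \frac{1}{\varepsilon^{\alpha(q,r)}},\qquad \max_t\left\|f_t-\mathbf{E}(f_t\mid\mathcal{P}'_{i_t}\otimes\mathcal{P}'_{j_t})\right\|_{S^{r_t}}\le\varepsilon\max_t\|f_t\|_{S^{q_t}}.$$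
   Context: $u\ll_{a,b,\ldots} v$ means $|u|\le c\,v$ for a constant $c$ depending only on $a,b,\ldots$. Finite probability spaces carry the full $\sigma$-algebra. For finite probability spaces $(X,\mathbf{P}_X),(Y,\mathbf{P}_Y)$, $X\times Y$ carries the product measure. For partitions $\mathcal{P}$ of $X$ and $\mathcal{Q}$ of $Y$: $|\mathcal{P}|$ is the number of parts; $\mathbf{H}(\mathcal{P}):=\sum_{A\in\mathcal{P}}\mathbf{P}_X(A)\log\frac{1}{\mathbf{P}_X(A)}$ (with $0\log\frac10:=0$); $\mathcal{P}\otimes\mathcal{Q}:=\{A\times B:A\in\mathcal{P},B\in\mathcal{Q}\}$; and $\mathbf{E}(f\mid\mathcal{P}\otimes\mathcal{Q})$ is the function equal on each part $A\times B$ to $\mathbf{E}[f\mathbf{1}_{A\times B}]/(\mathbf{P}_X(A)\mathbf{P}_Y(B))$ (values on parts of probability zero are immaterial). For $f:X\times Y\to\mathbf{C}$, $\|f\|_{S^q}$ is the $\ell^q$ norm (maximum if $q=\infty$) of the singular values of the $|X|\times|Y|$ matrix with $(x,y)$ entry $f(x,y)\sqrt{\mathbf{P}_X(x)\mathbf{P}_Y(y)}$, and $\|f\|_\square:=\sup_{A\subset X,B\subset Y}|\mathbf{E}_{x,y}[f(x,y)\mathbf{1}_A(x)\mathbf{1}_B(y)]|$ with $x,y$ sampled independently. *)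

(* Defs.v *)
From mathcomp Require Import all_boot all_order all_algebra.
From mathcomp Require Import spectral complex.
From mathcomp Require Import constructive_ereal reals exp.

Set Implicit Arguments.
Unset Strict Implicit.
Unset Printing Implicit Defensive.

Import Order.TTheory GRing.Theory Num.Theory.

Local Open Scope ring_scope.
Local Open Scope complex_scope.
Local Open Scope sesquilinear_scope.

Record finprob (R : realType) (T : finType) := FinProb {
  pmf :> T -> R;
  pmf_ge0 : forall x, 0 <= pmf x;
  pmf_sum1 : \sum_x pmf x = 1
}.

Definition Pr (R : realType) (T : finType) (P : finprob R T) (A : {set T}) : R :=
  \sum_(x in A) P x.

(* Expectation under the product of P and P'. *)
Definition expect2 (R : realType) (X Y : finType) (P : finprob R X)
    (P' : finprob R Y) (g : X -> Y -> R[i]) : R[i] :=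
  \sum_x \sum_y (P x * P' y)%:C * g x y.

Definition indicator (R : realType) (T : finType) (A : {set T}) (x : T) : R[i] :=
  (x \in A)%:R.

(* The summands with Pr P A = 0 vanish whatever the value of ln 0^-1. *)
Definition entropy (R : realType) (T : finType) (P : finprob R T)
    (Q : {set {set T}}) : R :=
  \sum_(A in Q) Pr P A * ln (Pr P A)^-1.

(* E(f | Q (x) Q'), for partitions Q of X and Q' of Y: the part containing
   (x, y) is pblock Q x * pblock Q' y.  On parts of probability zero the value
   is 0, as 0^-1 = 0. *)
Definition condexp (R : realType) (X Y : finType) (P : finprob R X)
    (P' : finprob R Y) (f : X -> Y -> R[i]) (Q : {set {set X}})
    (Q' : {set {set Y}}) (x : X) (y : Y) : R[i] :=
  let A := pblock Q x in
  let B := pblock Q' y in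
  expect2 P P' (fun x y => f x y * indicator R A x * indicator R B y)
    / (Pr P A * Pr P' B)%:C.

(* The square roots of the eigenvalues, with multiplicity, of the Hermitian
   positive semidefinite matrix A^* A.  There are n of them rather than
   minn m n: the additional ones are 0, and change neither the l^q norm
   (0 < q < oo) nor the maximum. *)
Definition singular_values (R : realType) (m n : nat) (A : 'M[R[i]]_(m, n)) :
    'rV[R]_n :=
  \row_j Num.sqrt (complex.Re (spectral_diag (A ^t* *m A) 0 j)).

(* The l^q norm of a vector with nonnegative entries; -oo is a junk value. *)
Definition lnorm (R : realType) (q : \bar R) (n : nat) (s : 'rV[R]_n) : R :=
  match q with
  | q'%:E%E => (\sum_j s 0 j `^ q') `^ q'^-1
  | +oo%E => \big[Num.max/0]_j s 0 j
  | -oo%E => 0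
  end.

Definition weighted_mx (R : realType) (X Y : finType) (P : finprob R X)
    (P' : finprob R Y) (f : X -> Y -> R[i]) : 'M[R[i]]_(#|X|, #|Y|) :=
  \matrix_(a, b) (f (enum_val a) (enum_val b)
    * (Num.sqrt (P (enum_val a) * P' (enum_val b)))%:C).

Definition schatten_norm (R : realType) (X Y : finType) (P : finprob R X)
    (P' : finprob R Y) (q : \bar R) (f : X -> Y -> R[i]) : R :=
  lnorm q (singular_values (weighted_mx P P' f)).

(* The supremum is over finitely many nonnegative reals. *)
Definition box_norm (R : realType) (X Y : finType) (P : finprob R X)
    (P' : finprob R Y) (f : X -> Y -> R[i]) : R :=
  \big[Num.max/0]_(A : {set X}) \big[Num.max/0]_(B : {set Y})
    ComplexField.Normc.normc
      (expect2 P P' (fun x y => f x y * indicator R A x * indicator R B y)).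

(* (+oo)^-1 = 0 in \bar R, so that q / r is 0 for r = +oo. *)
Definition alpha (R : realType) (q : R) (r : \bar R) : R :=
  2 ^ Num.max (Num.ceil (ln q / ln 2)) 1 / (1 - fine (q%:E / r)%E).

(* Main.v *)
Require Import Defs.
From mathcomp Require Import all_boot all_order all_algebra.
From mathcomp Require Import spectral complex.
From mathcomp Require Import constructive_ereal reals exp.
From mathcomp Require Import boolp ring lra.
From mathcomp Require classical_sets.

Set Implicit Arguments.
Unset Strict Implicit.
Unset Printing Implicit Defensive.

Import Order.TTheory GRing.Theory Num.Theory.

Local Open Scope ring_scope.

(** For q = 2 this is an energy increment argument. If E is the conditional
    expectation on the current partitions and the sesquilinear form of f - E f is
    large at some pair of functions in the unit balls (of l^oo for (a), of L^2 for
    (b)), then it is large at a pair of discretised functions; refining by their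
    level sets raises the squared L^2 norm of E f by a fixed amount, and costs
    O(1) in log-cardinality, resp. entropy. Exponents 2^(n+1) are reduced to 2^n
    by applying the result to f f^* and f^* f with precision of order eps^2: for
    w = g - E g the squared norm of f^* w is the form of f f^* at (w, w).

    Since q <= 2^(n+1), this bounds the operator norm of f - E f in (b), and
    s_j(f - E f) > 2 t holds for at most twice as many j as s_j(f) > t does, so
    that the S^q norm of f - E f is O(|f|_(S^q)); the S^r norm follows by
    interpolation. *)

(** One argument serves (a) and (b): a boolean selects the ball of test functions and, with it, the
    measure of complexity. In the L^2 case no constant bounds the number of level sets of a
    discretised test function; a code that is long only on large values still has bounded mean
    length, hence bounded entropy. Lengths add under common refinement, in the maximum and in the
    mean alike.

    Errors are tested on balls that averaging preserves, so refining a partition at most doubles an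
    error. This allows partitions found for different f_t, or for the two sides of f f^*, to be
    merged.

    Counting singular values replaces the contractivity of E on Schatten classes: it is linear
    algebra in l^2, and its constant factor is absorbed by using eps / 4 in place of eps. *)

Section FiniteL2.
Local Open Scope complex_scope.
Variable R : realType.
Implicit Types (a b c : R[i]) (r s t : R).

(** The real inner product of C as R^2. Real parts suffice because the balls of test functions are
    invariant under a phase, which turns a modulus into a real part. *)
Definition dotc a b : R := complex.Re a * complex.Re b + complex.Im a * complex.Im b.

Lemma Re_sum (I : Type) (e : seq I) (Q : pred I) (F : I -> R[i]) :
  complex.Re (\sum_(i <- e | Q i) F i) = \sum_(i <- e | Q i) complex.Re (F i).
Proof. by apply: (big_morph (@complex.Re R)) => // [[? ?] [? ?]]. Qed.

Lemma Im_sum (I : Type) (e : seq I) (Q : pred I) (F : I -> R[i]) :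
  complex.Im (\sum_(i <- e | Q i) F i) = \sum_(i <- e | Q i) complex.Im (F i).
Proof. by apply: (big_morph (@complex.Im R)) => // [[? ?] [? ?]]. Qed.

Lemma dotcE a b : dotc a b = complex.Re (conjc a * b).
Proof. by case: a b => [a1 a2] [b1 b2]; rewrite /dotc /=; ring. Qed.

Lemma dotcC a b : dotc a b = dotc b a.
Proof. by rewrite /dotc; ring. Qed.

Lemma dotcDl a b c : dotc (a + b) c = dotc a c + dotc b c.
Proof. by case: a b c => [? ?] [? ?] [? ?]; rewrite /dotc /=; ring. Qed.

Lemma dotcNl a b : dotc (- a) b = - dotc a b.
Proof. by case: a b => [? ?] [? ?]; rewrite /dotc /=; ring. Qed.

Lemma dotcZl r a b : dotc (r%:C * a) b = r * dotc a b.
Proof. by case: a b => [? ?] [? ?]; rewrite /dotc /=; ring. Qed.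

Lemma dotcZr r a b : dotc a (r%:C * b) = r * dotc a b.
Proof. by rewrite dotcC dotcZl dotcC. Qed.

Lemma dotc_suml (I : Type) (e : seq I) (Q : pred I) (F : I -> R[i]) b :
  dotc (\sum_(i <- e | Q i) F i) b = \sum_(i <- e | Q i) dotc (F i) b.
Proof.
rewrite /dotc Re_sum Im_sum !mulr_suml -big_split /=.
by apply: eq_bigr.
Qed.

Lemma dotc_sumr (I : Type) (e : seq I) (Q : pred I) (F : I -> R[i]) b :
  dotc b (\sum_(i <- e | Q i) F i) = \sum_(i <- e | Q i) dotc b (F i).
Proof.
by rewrite dotcC dotc_suml; apply: eq_bigr => i _; rewrite dotcC.
Qed.

Lemma dotc_ge0 a : 0 <= dotc a a.
Proof. by rewrite /dotc -!expr2 addr_ge0 ?sqr_ge0. Qed.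

Lemma dotcJ a b : dotc (conjc a) (conjc b) = dotc a b.
Proof. by case: a b => [? ?] [? ?]; rewrite /dotc /=; ring. Qed.

Lemma dotc_mul a b : dotc (a * b) (a * b) = dotc a a * dotc b b.
Proof. by case: a b => [? ?] [? ?]; rewrite /dotc /=; ring. Qed.

Lemma dotc0l b : dotc 0 b = 0.
Proof. by case: b => ? ?; rewrite /dotc /=; ring. Qed.

Lemma dotcD2 a b : dotc (a + b) (a + b) <= 2 * dotc a a + 2 * dotc b b.
Proof.
case: a b => [a1 a2] [b1 b2]; rewrite /dotc /=.
by have := sqr_ge0 (a1 - b1); have := sqr_ge0 (a2 - b2); nra.
Qed.

Lemma dotc_le a b : dotc a b <= (dotc a a + dotc b b) / 2.
Proof.
case: a b => [a1 a2] [b1 b2]; rewrite /dotc /=.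
by have := sqr_ge0 (a1 - b1); have := sqr_ge0 (a2 - b2); nra.
Qed.

(** * Inner products, conditional expectations and balls *)

Section Inner.
Variables (T : finType) (P : finprob R T).
Implicit Types (g h k : T -> R[i]).

Definition inner g h : R := \sum_x P x * dotc (g x) (h x).

Lemma innerC g h : inner g h = inner h g.
Proof. by apply: eq_bigr => x _; rewrite dotcC. Qed.

Lemma innerBl g h k : inner (fun x => g x - h x) k = inner g k - inner h k.
Proof.
rewrite /inner -sumrB; apply: eq_bigr => x _.
by rewrite dotcDl dotcNl mulrBr.
Qed.

Lemma innerBr g h k : inner k (fun x => g x - h x) = inner k g - inner k h.
Proof. by rewrite innerC innerBl !(innerC k). Qed.

Lemma innerZl r g h : inner (fun x => r%:C * g x) h = r * inner g h.
Proof.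
by rewrite mulr_sumr; apply: eq_bigr => x _; rewrite dotcZl mulrCA.
Qed.

Lemma innerZr r g h : inner h (fun x => r%:C * g x) = r * inner h g.
Proof. by rewrite innerC innerZl innerC. Qed.

Lemma inner_ge0 g : 0 <= inner g g.
Proof. by apply: sumr_ge0 => x _; rewrite mulr_ge0 ?pmf_ge0 ?dotc_ge0. Qed.

Lemma eq_inner g g' h h' :
  (forall x, P x != 0 -> g x = g' x) -> (forall x, P x != 0 -> h x = h' x) ->
  inner g h = inner g' h'.
Proof.
move=> eg eh; apply: eq_bigr => x _.
by have [->|Px] := eqVneq (P x) 0; rewrite ?mul0r // eg // eh.
Qed.

Lemma inner_quad r g h : 0 <= inner g g - 2 * r * inner g h + r ^+ 2 * inner h h.
Proof.
have := inner_ge0 (fun x => g x - r%:C * h x).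
rewrite innerBl !innerBr !innerZl !innerZr (innerC h g).
by move=> ?; lra.
Qed.

Lemma inner_CS g h : inner g h ^+ 2 <= inner g g * inner h h.
Proof.
have q := fun r => inner_quad r g h.
move: (inner_ge0 g) (inner_ge0 h) q.
set a := inner g g; set b := inner g h; set c := inner h h => a0 c0 q.
have [c_eq|c_neq] := eqVneq c 0.
  have [->|b_neq] := eqVneq b 0; first by rewrite expr0n /= mulr_ge0.
  (* With [c = 0] the quadratic is affine in r, and equals -1 at this r. *)
  have := q ((a + 1) / (2 * b)); rewrite c_eq mulr0 addr0.
  have -> : 2 * ((a + 1) / (2 * b)) * b = a + 1 by field.
  by move=> ?; exfalso; lra.
have c_gt0 : 0 < c by rewrite lt_neqAle eq_sym c_neq.
have := q (b / c).
have -> : a - 2 * (b / c) * b + (b / c) ^+ 2 * c = (a * c - b ^+ 2) / c by field.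
by rewrite pmulr_lge0 ?invr_gt0 // subr_ge0.
Qed.

Lemma inner_le g h s t : 0 <= s -> 0 <= t -> inner g g <= s ^+ 2 ->
  inner h h <= t ^+ 2 -> inner g h <= s * t.
Proof.
move=> s0 t0 gs ht; have := inner_CS g h => cs.
have [|b0] := leP (inner g h) 0; first by move/le_trans; apply; rewrite mulr_ge0.
rewrite -(@ler_pXn2r _ 2) ?nnegrE ?mulr_ge0 // ?(ltW b0) //.
by rewrite (le_trans cs) // exprMn ler_pM ?inner_ge0.
Qed.

End Inner.

Section CondExp.
Variables (T : finType) (P : finprob R T) (L : eqType) (l : T -> L).
Implicit Types (g h k : T -> R[i]).

Definition cell_weight x : R := \sum_(y | l y == l x) P y.

(** A kernel with respect to [P]. As 0^-1 = 0 it vanishes on cells of weight zero, so it integrates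
    to at most 1, and [cexp] is 0 on such cells. *)
Definition cexp_ker x y : R := if l y == l x then (cell_weight x)^-1 else 0.

Definition cexp g x : R[i] := \sum_y (cexp_ker x y * P y)%:C * g y.

Definition measurable_for g := forall x y, l x = l y -> g x = g y.

Lemma cell_weight_eq x y : l x = l y -> cell_weight x = cell_weight y.
Proof. by move=> e; apply: eq_bigl => z; rewrite e. Qed.

Lemma cexp_kerC x y : cexp_ker x y = cexp_ker y x.
Proof.
rewrite /cexp_ker (eq_sym (l x)); case: eqP => // e.
by rewrite (cell_weight_eq e).
Qed.

Lemma cell_weight_ge0 x : 0 <= cell_weight x.
Proof. by apply: sumr_ge0 => y _; apply: pmf_ge0. Qed.

Lemma cexp_ker_ge0 x y : 0 <= cexp_ker x y.
Proof. by rewrite /cexp_ker; case: ifP => // _; rewrite invr_ge0 cell_weight_ge0. Qed.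

Lemma cell_weight_gt0 x : P x != 0 -> 0 < cell_weight x.
Proof.
move=> Px; have lt : 0 < P x by rewrite lt_neqAle eq_sym Px pmf_ge0.
apply: lt_le_trans lt _; rewrite /cell_weight (bigD1 x) //= lerDl.
by apply: sumr_ge0 => y _; apply: pmf_ge0.
Qed.

Lemma cexp_ker_sum x : \sum_y cexp_ker x y * P y = (cell_weight x)^-1 * cell_weight x.
Proof.
rewrite /cell_weight mulr_sumr [RHS]big_mkcond; apply: eq_bigr => y _.
by rewrite /cexp_ker; case: ifP; rewrite ?mul0r.
Qed.

Lemma cexp_ker_sum_le1 x : \sum_y cexp_ker x y * P y <= 1.
Proof.
rewrite cexp_ker_sum; have [->|nz] := eqVneq (cell_weight x) 0.
  by rewrite mulr0 ler01.
by rewrite mulVf.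
Qed.

Lemma cexp_measurable g : measurable_for (cexp g).
Proof.
move=> x y e; apply: eq_bigr => z _.
by rewrite /cexp_ker e (cell_weight_eq e).
Qed.

Lemma cexp_id g x : measurable_for g -> P x != 0 -> cexp g x = g x.
Proof.
move=> mg Px; have -> : cexp g x = \sum_y (cexp_ker x y * P y)%:C * g x.
  apply: eq_bigr => y _; rewrite /cexp_ker; case: eqP => [e|_]; first by rewrite (mg _ _ e).
  by rewrite mul0r !mul0r.
rewrite -mulr_suml -rmorph_sum /= cexp_ker_sum mulVf ?mul1r //.
by rewrite gt_eqF ?cell_weight_gt0.
Qed.

Lemma cexp_adj g h : inner P (cexp g) h = inner P g (cexp h).
Proof.
rewrite /inner.
have -> : \sum_x P x * dotc (cexp g x) (h x) =
    \sum_x \sum_y P x * P y * cexp_ker x y * dotc (g y) (h x).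
  apply: eq_bigr => x _; rewrite dotc_suml mulr_sumr; apply: eq_bigr => y _.
  by rewrite dotcZl; ring.
rewrite exchange_big; apply: eq_bigr => y _; rewrite dotc_sumr mulr_sumr.
by apply: eq_bigr => x _; rewrite dotcZr cexp_kerC; ring.
Qed.

Lemma inner_cexp g : inner P (cexp g) (cexp g) = inner P g (cexp g).
Proof.
rewrite cexp_adj; apply: eq_inner => // x Px.
by rewrite cexp_id //; apply: cexp_measurable.
Qed.

Lemma cexpB g h x : cexp (fun x => g x - h x) x = cexp g x - cexp h x.
Proof. by rewrite /cexp -sumrB; apply: eq_bigr => y _; rewrite mulrBr. Qed.

Lemma cexp_contract g : inner P (cexp g) (cexp g) <= inner P g g.
Proof.
have := inner_ge0 P (fun x => g x - cexp g x).
by rewrite innerBl !innerBr inner_cexp (innerC P (cexp g)); lra.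
Qed.

(** Pairing the average z with each value through [dotc_le] gives |z|^2 <= (r + |z|^2) / 2, hence
    |z|^2 <= r. *)
Lemma cexp_contract_sup g r : (forall x, dotc (g x) (g x) <= r) ->
  forall x, dotc (cexp g x) (cexp g x) <= r.
Proof.
move=> gr x; have [z zE] : exists z, z = cexp g x by exists (cexp g x).
rewrite -zE; have r0 : 0 <= r by apply: le_trans (gr x); apply: dotc_ge0.
have z0 := dotc_ge0 z.
suff : dotc z z <= (r + dotc z z) / 2 by lra.
apply: (@le_trans _ _ (\sum_y cexp_ker x y * P y * ((r + dotc z z) / 2))).
  rewrite {1}zE dotc_suml; apply: ler_sum => y _; rewrite dotcZl.
  rewrite ler_wpM2l ?mulr_ge0 ?cexp_ker_ge0 ?pmf_ge0 //.
  by have := gr y; have := dotc_le (g y) z; lra.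
rewrite -mulr_suml; apply: ler_piMl; last exact: cexp_ker_sum_le1.
by lra.
Qed.

End CondExp.

Section Refine.
Variables (T : finType) (P : finprob R T) (L1 L2 : eqType).
Variables (l1 : T -> L1) (l2 : T -> L2).
Hypothesis l21 : forall x y, l2 x = l2 y -> l1 x = l1 y.
Implicit Types (g h : T -> R[i]).

Lemma cexp_refine_l g x : P x != 0 -> cexp P l2 (cexp P l1 g) x = cexp P l1 g x.
Proof.
move=> Px; apply: cexp_id => // y z e.
by apply: cexp_measurable; apply: l21.
Qed.

Lemma inner_cexp_refine g : inner P (cexp P l2 g) (cexp P l1 g) =
  inner P (cexp P l1 g) (cexp P l1 g).
Proof.
rewrite cexp_adj inner_cexp; apply: eq_inner => // x Px.
exact: cexp_refine_l.
Qed.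

(** Pythagoras: the coarse average is the orthogonal projection of the fine one. *)
Lemma cexp_energy g :
  let d := fun x => cexp P l2 g x - cexp P l1 g x in
  inner P d d = inner P (cexp P l2 g) (cexp P l2 g)
                - inner P (cexp P l1 g) (cexp P l1 g).
Proof.
rewrite /= innerBl !innerBr inner_cexp_refine (innerC P (cexp P l1 g)).
by rewrite inner_cexp_refine; ring.
Qed.

End Refine.

Section Ball.
Variables (T : finType) (P : finprob R T) (b : bool).
Implicit Types (g h : T -> R[i]).

(* The ball of radius [sqrt r]: of l^oo if [b], of L^2 otherwise. *)
Definition in_ball r g :=
  if b then forall x, dotc (g x) (g x) <= r else inner P g g <= r.

Lemma in_ball_L2 r g : in_ball r g -> inner P g g <= r.
Proof.
rewrite /in_ball; case: b => // gr; rewrite -[r]mul1r -(pmf_sum1 P) mulr_suml.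
by apply: ler_sum => x _; rewrite ler_wpM2l ?pmf_ge0.
Qed.

Lemma in_ball_sup r g : (forall x, dotc (g x) (g x) <= r) -> in_ball r g.
Proof.
move=> gr; rewrite /in_ball; case: b => //.
rewrite -[r]mul1r -(pmf_sum1 P) mulr_suml.
by apply: ler_sum => x _; rewrite ler_wpM2l ?pmf_ge0.
Qed.

Lemma in_ball_dom r s g h : 0 <= s ->
  (forall x, dotc (h x) (h x) <= s * dotc (g x) (g x)) ->
  in_ball r g -> in_ball (s * r) h.
Proof.
move=> s0; rewrite /in_ball; case: b => hg gr.
  by move=> x; apply: le_trans (hg x) _; rewrite ler_wpM2l.
apply: (@le_trans _ _ (s * inner P g g)); last by rewrite ler_wpM2l.
rewrite mulr_sumr; apply: ler_sum => x _.
by rewrite mulrCA ler_wpM2l ?pmf_ge0.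
Qed.

Lemma in_ballZ r s g : in_ball r g -> in_ball (s ^+ 2 * r) (fun x => s%:C * g x).
Proof.
apply: in_ball_dom => [|x]; first exact: sqr_ge0.
by rewrite dotcZl dotcZr mulrA expr2.
Qed.

Lemma in_ball_cexp (L : eqType) (l : T -> L) r g :
  in_ball r g -> in_ball r (cexp P l g).
Proof.
rewrite /in_ball; case: b => gr; first exact: cexp_contract_sup.
by apply: le_trans gr; apply: cexp_contract.
Qed.

Lemma in_ballB r g h :
  in_ball r g -> in_ball r h -> in_ball (4 * r) (fun x => g x - h x).
Proof.
have dB x : dotc (g x - h x) (g x - h x) <= 2 * dotc (g x) (g x) + 2 * dotc (h x) (h x).
  by apply: le_trans (dotcD2 _ _) _; rewrite dotcNl (dotcC (h x)) dotcNl opprK.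
rewrite /in_ball; case: b => gr hr.
  by move=> x; have := gr x; have := hr x; have := dB x; lra.
apply: (@le_trans _ _ (2 * inner P g g + 2 * inner P h h)); last by lra.
rewrite /inner !mulr_sumr -big_split; apply: ler_sum => x _ /=.
have := dB x; have := pmf_ge0 P x.
set A := dotc _ _; set B := dotc _ _; set D := dotc _ _; nra.
Qed.

End Ball.

End FiniteL2.

(** * Codes: lengths, joins, and discretised functions *)

Section Codes.
Local Open Scope complex_scope.
Variable R : realType.

(* A labelling together with weights satisfying Kraft's inequality: such a
   labelling has entropy at most the mean of [- ln (cweight (clabel x))], and at
   most [expR s] labels if that is at most [s] everywhere. *)
Record code (X : finType) := Code {
  clabel_type : finType;
  clabel : X -> clabel_type;
  cweight : clabel_type -> R;
  cweight_gt0 : forall j, 0 < cweight j;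
  cweight_sum : \sum_j cweight j <= 1
}.
Arguments clabel {X} c x : rename.

Definition clen (X : finType) (c : code X) (x : X) : R :=
  - ln (cweight (clabel c x)).

(** The boolean is that of [in_ball]: maximal length, which controls the number of parts, goes with
    l^oo, and mean length, which controls entropy, with L^2. *)
Definition cost_le (b : bool) (X : finType) (P : finprob R X) (c : code X) (s : R) :=
  if b then forall x, clen c x <= s else \sum_x P x * clen c x <= s.

Lemma cost_le_sup b (X : finType) (P : finprob R X) (c : code X) (s : R) :
  (forall x, clen c x <= s) -> cost_le b P c s.
Proof.
move=> cs; rewrite /cost_le; case: b => //.
rewrite -[s]mul1r -(pmf_sum1 P) mulr_suml.
by apply: ler_sum => x _; rewrite ler_wpM2l ?pmf_ge0.
Qed.

Lemma cost_leW b (X : finType) (P : finprob R X) (c : code X) (s t : R) :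
  s <= t -> cost_le b P c s -> cost_le b P c t.
Proof.
rewrite /cost_le; case: b => st cs; last exact: le_trans cs st.
by move=> x; apply: le_trans (cs x) st.
Qed.

Section Join.
Variables (X : finType) (c d : code X).

Lemma join_weight_sum :
  \sum_(j : clabel_type c * clabel_type d) cweight j.1 * cweight j.2 <= 1.
Proof.
rewrite -(pair_big predT predT (fun i j => @cweight _ c i * @cweight _ d j)) /=.
under eq_bigr do rewrite -mulr_sumr.
rewrite -mulr_suml -[1]mulr1 ler_pM ?cweight_sum //.
- by apply: sumr_ge0 => j _; apply/ltW/cweight_gt0.
- by apply: sumr_ge0 => j _; apply/ltW/cweight_gt0.
Qed.

Definition code_join : code X := Code
  (fun x => (clabel c x, clabel d x))
  (fun j => mulr_gt0 (cweight_gt0 j.1) (cweight_gt0 j.2)) join_weight_sum.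

Lemma clen_join x : clen code_join x = clen c x + clen d x.
Proof. by rewrite /clen /= lnM ?posrE ?cweight_gt0 // opprD. Qed.

Lemma cost_join b (P : finprob R X) s t :
  cost_le b P c s -> cost_le b P d t -> cost_le b P code_join (s + t).
Proof.
rewrite /cost_le; case: b => cs dt.
  by move=> x; rewrite clen_join lerD.
under eq_bigr do rewrite clen_join mulrDr.
by rewrite big_split lerD.
Qed.

Lemma join_refine_l x y :
  clabel code_join x = clabel code_join y -> clabel c x = clabel c y.
Proof. by case. Qed.

Lemma join_refine_r x y :
  clabel code_join x = clabel code_join y -> clabel d x = clabel d y.
Proof. by case. Qed.

End Join.

Lemma unit_weight_sum : \sum_(j : unit) (1 : R) <= 1.
Proof. by rewrite big_const card_unit /= addr0. Qed.

Definition code_trivial (X : finType) : code X :=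
  Code (fun _ : X => tt) (fun _ => ltr01) unit_weight_sum.

Lemma cost_trivial b (X : finType) (P : finprob R X) :
  cost_le b P (code_trivial X) 0.
Proof. by apply: cost_le_sup => x; rewrite /clen /= ln1 oppr0. Qed.

Lemma half_pow_gt0 (n : nat) : 0 < (2^-1 : R) ^+ n.
Proof. by rewrite exprn_gt0 // invr_gt0. Qed.

Lemma geometric_weight_sum (n : nat) : \sum_(j < n) (2^-1 : R) ^+ j.+1 <= 1.
Proof.
have -> : \sum_(j < n) (2^-1 : R) ^+ j.+1 = 1 - 2^-1 ^+ n.
  elim: n => [|n IH]; first by rewrite big_ord0 expr0 subrr.
  by rewrite big_ord_recr IH /= exprS; field.
by rewrite lerBlDr lerDl ltW ?half_pow_gt0.
Qed.

Section NatCode.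
Variables (X : finType) (n : X -> nat).

(** Geometric weights make the length linear in the label, so the mean cost is governed by the first
    moment of [n], however large its maximum. *)
Definition code_nat : code X := Code
  (fun x : X => @inord (\max_x n x) (n x)) (fun j : 'I_(\max_x n x).+1 => half_pow_gt0 j.+1)
  (geometric_weight_sum _).

Lemma code_nat_valK x : nat_of_ord (clabel code_nat x) = n x.
Proof. by rewrite inordK // ltnS (leq_bigmax x). Qed.

Lemma clen_nat x : clen code_nat x <= (n x)%:R + 1.
Proof.
rewrite /clen [cweight _]/(2^-1 ^+ _) code_nat_valK.
rewrite lnXn ?invr_gt0 // lnV ?posrE // mulNrn opprK.
rewrite natr1 -[X in X <= _]mulr_natl.
(* What remains is ln 2 <= 1, from exp 1 >= 1 + 1. *)
by rewrite ler_piMr // -(ler_expR) lnK ?posrE // (le_trans _ (expR_ge1Dx _)) // -natr1.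
Qed.

Lemma code_nat_inj x y : clabel code_nat x = clabel code_nat y -> n x = n y.
Proof. by move/(congr1 (@nat_of_ord _)); rewrite !code_nat_valK. Qed.

End NatCode.

(** Rounding goes towards zero, on the grid of step 1/4, so that a discretised function stays in the
    ball of the original. *)
Definition trunc4 (r : R) : R :=
  (if r < 0 then -1 else 1) * ((Num.truncn (4 * `|r|))%:R / 4).

Lemma trunc4_code (X : finType) (a : X -> R) : exists c : code X,
  (forall x, clen c x <= 4 * `|a x| + 3) /\
  (forall x y, clabel c x = clabel c y -> trunc4 (a x) = trunc4 (a y)).
Proof.
(* One label for the sign, of length at most 2, and one for the modulus, of length at most 4 |a| +
   1. *)
exists (code_join (code_nat (fun x => nat_of_bool (a x < 0)))
                  (code_nat (fun x => Num.truncn (4 * `|a x|)))); split.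
  move=> x; rewrite clen_join.
  have a0 : 0 <= 4 * `|a x| by rewrite mulr_ge0.
  have := clen_nat (fun x => nat_of_bool (a x < 0)) x.
  have := clen_nat (fun x => Num.truncn (4 * `|a x|)) x.
  have := truncn_le (4 * `|a x|); rewrite a0.
  have : (nat_of_bool (a x < 0))%:R <= 1 :> R by case: (a x < 0).
  lra.
move=> x y e.
rewrite /trunc4 (code_nat_inj (join_refine_r e)).
have := code_nat_inj (join_refine_l e).
by case: (a x < 0); case: (a y < 0).
Qed.

Lemma trunc4_le r : trunc4 r ^+ 2 <= r ^+ 2.
Proof.
have a0 : 0 <= 4 * `|r| by rewrite mulr_ge0.
have := truncn_le (4 * `|r|); rewrite a0 /trunc4 => t.
rewrite exprMn -[r ^+ 2]real_normK ?num_real //.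
have -> : (if r < 0 then -1 else 1) ^+ 2 = 1 :> R by case: ifP; rewrite ?sqrrN expr1n.
rewrite mul1r ler_pXn2r ?nnegrE ?divr_ge0 //; lra.
Qed.

Lemma trunc4_dist r : (r - trunc4 r) ^+ 2 <= (1 / 4) ^+ 2.
Proof.
have a0 : 0 <= 4 * `|r| by rewrite mulr_ge0.
have := truncn_le (4 * `|r|); rewrite a0 => t1.
have := truncnS_gt (4 * `|r|); rewrite -[X in _ < X]natr1 => t2.
have -> : r - trunc4 r = (if r < 0 then -1 else 1) * (`|r| - (Num.truncn (4 * `|r|))%:R / 4).
  rewrite /trunc4; case: ltP => r0; first by rewrite ltr0_norm //; ring.
  by rewrite ger0_norm //; ring.
rewrite exprMn; have -> : (if r < 0 then -1 else 1) ^+ 2 = 1 :> R by case: ifP; rewrite ?sqrrN expr1n.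
rewrite [X in X <= _]mul1r ler_pXn2r ?nnegrE //; lra.

Qed.

Definition disc (z : R[i]) : R[i] := trunc4 (complex.Re z) +i* trunc4 (complex.Im z).

Lemma disc_le z : dotc (disc z) (disc z) <= dotc z z.
Proof. by rewrite /dotc /= -!expr2 lerD ?trunc4_le. Qed.

Lemma disc_dist z : dotc (z - disc z) (z - disc z) <= 1 / 8.
Proof.
case: z => a b; rewrite /dotc /= -!expr2.
by have := trunc4_dist a; have := trunc4_dist b; lra.
Qed.

(** The length 4 |Re g| + 4 |Im g| + 6 is at most 10 + 2 |g|^2, as 4 |r| <= 2 + 2 r^2; so the square
    norm that defines the ball bounds the cost, by 12. *)
Lemma disc_code b (X : finType) (P : finprob R X) (g : X -> R[i]) :
  in_ball P b 1 g -> exists c : code X, cost_le b P c 12 /\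
    measurable_for (clabel c) (fun x => disc (g x)).
Proof.
move=> gb.
have [c [cl cm]] := trunc4_code (fun x => complex.Re (g x)).
have [d [dl dm]] := trunc4_code (fun x => complex.Im (g x)).
exists (code_join c d); split; last first.
  move=> x y e; rewrite /disc (cm _ _ (join_refine_l e)).
  by rewrite (dm _ _ (join_refine_r e)).
have le2 : forall x, clen (code_join c d) x <= 10 + 2 * dotc (g x) (g x).
  move=> x; rewrite clen_join; have := cl x; have := dl x.
  have sq (r : R) : 4 * `|r| <= 2 + 2 * (r * r).
    rewrite -[r * r]expr2 -real_normK ?num_real //.
    by have := sqr_ge0 (`|r| - 1); nra.
  have := sq (complex.Re (g x)); have := sq (complex.Im (g x)); rewrite /dotc; lra.
move: gb; rewrite /in_ball /cost_le; case: b => gb.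
  by move=> x; apply: le_trans (le2 x) _; have := gb x; lra.
apply: (@le_trans _ _ (10 + 2 * inner P g g)); last by lra.
have -> : 10 + 2 * inner P g g = \sum_x P x * (10 + 2 * dotc (g x) (g x)).
  under eq_bigr do rewrite mulrDr; rewrite big_split -mulr_suml pmf_sum1 mul1r.
  by rewrite /inner mulr_sumr; congr (_ + _); apply: eq_bigr => x _; rewrite mulrCA.
by apply: ler_sum => x _; rewrite ler_wpM2l ?pmf_ge0.
Qed.

End Codes.
Arguments clabel {R X} c x : rename.

(** * Forms, and conditional expectations on product spaces *)

Section Form.
Local Open Scope complex_scope.
Variable R : realType.
Variables (X Y : finType) (P : finprob R X) (P' : finprob R Y).

Lemma conjcZ (r : R) (a : R[i]) : conjc (r%:C * a) = r%:C * conjc a.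
Proof. by rewrite (rmorphM (@conjc R)); congr (_ * _); apply: conjc_real. Qed.

Lemma conjc_sum (I : Type) (e : seq I) (Q : pred I) (F : I -> R[i]) :
  conjc (\sum_(i <- e | Q i) F i) = \sum_(i <- e | Q i) conjc (F i).
Proof. exact: (rmorph_sum (@conjc R)). Qed.

Lemma prodp_ge0 (z : X * Y) : 0 <= P z.1 * P' z.2.
Proof. by rewrite mulr_ge0 ?pmf_ge0. Qed.

Lemma prodp_sum1 : \sum_(z : X * Y) P z.1 * P' z.2 = 1.
Proof.
rewrite -(pair_big predT predT (fun x y => P x * P' y)) /=.
under eq_bigr do rewrite -mulr_sumr.
by rewrite -mulr_suml !pmf_sum1 mulr1.
Qed.

Definition prodp : finprob R (X * Y)%type := FinProb prodp_ge0 prodp_sum1.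

Definition tens (g : X -> R[i]) (h : Y -> R[i]) (z : X * Y) : R[i] :=
  g z.1 * conjc (h z.2).

Definition unc (f : X -> Y -> R[i]) (z : X * Y) : R[i] := f z.1 z.2.

(** The real part of E conj(g(x)) f(x, y) h(y), seen as an inner product on the product space, where
    [cexp] applies. *)
Definition form g f h : R := inner prodp (tens g h) (unc f).

Lemma tens_norm g h : inner prodp (tens g h) (tens g h) = inner P g g * inner P' h h.
Proof.
rewrite /inner -(pair_big predT predT
  (fun x y => P x * P' y * dotc (g x * conjc (h y)) (g x * conjc (h y)))) /=.
rewrite mulr_suml; apply: eq_bigr => x _; rewrite mulr_sumr.
by apply: eq_bigr => y _; rewrite dotc_mul dotcJ; ring.
Qed.

Section Labels.
Variables (L L' : eqType) (l : X -> L) (l' : Y -> L').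

Definition pair_label (z : X * Y) := (l z.1, l' z.2).

Definition bcexp (f : X -> Y -> R[i]) : X * Y -> R[i] := cexp prodp pair_label (unc f).

(** A cell of the pair label is a rectangle, whose mass is a product. *)
Lemma cexp_ker_pair z w : cexp_ker prodp pair_label z w =
  cexp_ker P l z.1 w.1 * cexp_ker P' l' z.2 w.2.
Proof.
rewrite /cexp_ker /pair_label -[(_, _) == _]/((_ == _) && (_ == _)) /=.
case: eqP => _ /=; last by rewrite mul0r.
case: eqP => _ /=; last by rewrite mulr0.
rewrite -invfM; congr (_^-1); rewrite /cell_weight /=.
rewrite -(pair_big (fun x => l x == l z.1) (fun y => l' y == l' z.2) (fun x y => P x * P' y)) /=.
by rewrite mulr_suml; apply: eq_bigr => x _; rewrite mulr_sumr.
Qed.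

Lemma cexp_tens g h z : cexp prodp pair_label (tens g h) z =
  tens (cexp P l g) (cexp P' l' h) z.
Proof.
rewrite /tens /cexp conjc_sum mulr_suml.
under [RHS]eq_bigr do rewrite mulr_sumr.
rewrite pair_big /=; apply: eq_bigr => w _.
by rewrite cexp_ker_pair conjcZ !rmorphM /=; ring.
Qed.

Lemma form_cexp g f h :
  form (cexp P l g) f (cexp P' l' h) = inner prodp (tens g h) (bcexp f).
Proof.
rewrite /bcexp -cexp_adj; apply: eq_inner => // z _; exact/esym/cexp_tens.
Qed.

(** The expectation is put on the test functions rather than on f; in this shape the error can be
    split one variable at a time. *)
Definition form_err g f h : R := form g f h - form (cexp P l g) f (cexp P' l' h).

Lemma form_errE g f h :
  form_err g f h = inner prodp (tens g h) (fun z => unc f z - bcexp f z).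
Proof. by rewrite /form_err form_cexp innerBr. Qed.

(** One-sided, yet it bounds the absolute value, because the balls contain -g along with g. *)
Definition reg_bound b f s := forall g h,
  in_ball P b 1 g -> in_ball P' b 1 h -> form_err g f h <= s.

End Labels.

Lemma formBl g g' f h : form (fun x => g x - g' x) f h = form g f h - form g' f h.
Proof.
rewrite /form -innerBl; apply: eq_inner => // z _.
by rewrite /tens mulrBl.
Qed.

Lemma formBr g f h h' : form g f (fun x => h x - h' x) = form g f h - form g f h'.
Proof.
rewrite /form -innerBl; apply: eq_inner => // z _.
by rewrite /tens rmorphB mulrBr.
Qed.

End Form.

(** * Regularity for S^2: bootstrap and energy increment *)

Section FrobeniusRegularity.
Local Open Scope complex_scope.
Variable R : realType.
Variables (X Y : finType) (P : finprob R X) (P' : finprob R Y).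
Variable f : X -> Y -> R[i].

Section Bootstrap.
Variables (L L' : eqType) (l : X -> L) (l' : Y -> L').
Local Notation err g h := (form_err P P' l l' g f h).

Lemma form_errBl g g' h : err (fun x => g x - g' x) h = err g h - err g' h.
Proof.
rewrite !form_errE -innerBl; apply: eq_inner => // z _.
by rewrite /tens mulrBl.
Qed.

Lemma form_errBr g h h' : err g (fun x => h x - h' x) = err g h - err g h'.
Proof.
rewrite !form_errE -innerBl; apply: eq_inner => // z _.
by rewrite /tens (rmorphB (@conjc R)) mulrBr.
Qed.

Lemma form_errZl r g h : err (fun x => r%:C * g x) h = r * err g h.
Proof.
rewrite !form_errE -innerZl; apply: eq_inner => // z _.
by rewrite /tens mulrA.
Qed.

Lemma form_errZr r g h : err g (fun x => r%:C * h x) = r * err g h.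
Proof.
rewrite !form_errE -innerZl; apply: eq_inner => // z _.
by rewrite /tens conjcZ mulrCA.
Qed.

Lemma reg_boundZ b N s t g h : 0 < s -> 0 < t -> reg_bound P P' l l' b f N ->
  in_ball P b (s ^+ 2) g -> in_ball P' b (t ^+ 2) h -> err g h <= s * t * N.
Proof.
move=> s0 t0 bN gs ht.
have := bN (fun x => (s^-1)%:C * g x) (fun x => (t^-1)%:C * h x).
rewrite form_errZl form_errZr => H.
have : s^-1 * (t^-1 * err g h) <= N.
  apply: H.
    by have := in_ballZ s^-1 gs; rewrite -exprMn mulVf ?expr1n ?gt_eqF.
  by have := in_ballZ t^-1 ht; rewrite -exprMn mulVf ?expr1n ?gt_eqF.
by rewrite ler_pdivrMl // ler_pdivrMl // mulrA (mulrC s).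
Qed.

Lemma in_ball_disc b r (Z : finType) (Q : finprob R Z) (g : Z -> R[i]) :
  in_ball Q b r g -> in_ball Q b r (fun x => disc (g x)).
Proof.
move=> gr; rewrite -[r]mul1r; apply: in_ball_dom gr => // x.
by rewrite mul1r disc_le.
Qed.

(* The supremum S of the error form over the balls satisfies
   S <= theta + 3/4 S, as discretisation errors lie in 3/8 of the ball. *)
Lemma reg_bound_disc b theta :
  (forall g h, in_ball P b 1 g -> in_ball P' b 1 h ->
    err (fun x => disc (g x)) (fun y => disc (h y)) <= theta) ->
  reg_bound P P' l l' b f (4 * theta).
Proof.
move=> dt.
pose E := fun r : R => exists g h,
  [/\ in_ball P b 1 g, in_ball P' b 1 h & r = err g h].
pose F z := unc f z - bcexp P P' l l' f z.
have F0 := inner_ge0 (prodp P P') F.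
(* The supremum must be finite before it can absorb a multiple of itself; Cauchy-Schwarz gives a
   crude bound. *)
have Eub : classical_sets.has_ubound E.
  exists (1 * (1 + inner (prodp P P') F F)) => _ [g [h [gb hb ->]]].
  rewrite form_errE; apply: inner_le => //.
  - by rewrite addr_ge0.
  - rewrite tens_norm expr1n -[1]mulr1.
    by rewrite ler_pM ?inner_ge0 // ?mulr1; [apply: in_ball_L2 gb | apply: in_ball_L2 hb].
  - by rewrite -/F; nra.
have E0 : classical_sets.has_sup E.
  split => //; exists (err (fun=> 0) (fun=> 0)); exists (fun=> 0), (fun=> 0).
  by split => //; apply: in_ball_sup => x; rewrite dotc0l ler01.
have bS : reg_bound P P' l l' b f (sup E).
  by move=> g h gb hb; apply: ub_le_sup => //; exists g, h.
have S_le : sup E <= theta + 3 / 4 * sup E.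
  apply: ge_sup; first by case: E0.
  move=> _ [g [h [gb hb ->]]].
  (* Real and imaginary parts contribute 1/16 each, and 1/8 <= (3/8)^2. *)
  have small (Z : finType) (Q : finprob R Z) (k : Z -> R[i]) :
      in_ball Q b ((3 / 8) ^+ 2) (fun x => k x - disc (k x)).
    by apply: in_ball_sup => x; apply: le_trans (disc_dist _) _; lra.
  have one : (1 : R) = 1 ^+ 2 by rewrite expr1n.
  (* Together, [e1] and [e2] write the error at (g, h) as the error at the discretised pair plus two
     terms with one argument of radius 3/8. *)
  have e1 := form_errBl g (fun x => disc (g x)) (fun x => disc (h x)).
  have e2 := form_errBr g h (fun x => disc (h x)).
  have := dt _ _ gb hb.
  have := @reg_boundZ b (sup E) (3 / 8) 1 (fun x => g x - disc (g x)) (fun x => disc (h x)).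
  have := @reg_boundZ b (sup E) 1 (3 / 8) g (fun x => h x - disc (h x)).
  rewrite -!one e1 e2 => /(_ ltr01) A /(_ _ ltr01) B.
  have := A _ bS gb (small _ _ _); have := B _ bS (small _ _ _) (in_ball_disc hb).
  have -> : 0 < 3 / 8 :> R by lra.
  by move=> /(_ isT) ? /(_ isT) ? ?; lra.
by move=> g h gb hb; apply: le_trans (bS g h gb hb) _; lra.
Qed.

End Bootstrap.

Definition energy (c : code R X) (c' : code R Y) : R :=
  let e := bcexp P P' (clabel c) (clabel c') f in inner (prodp P P') e e.

Lemma energy_le c c' : energy c c' <= inner (prodp P P') (unc f) (unc f).
Proof. exact: cexp_contract. Qed.

(** The product of the discretised functions is measurable for the refinement, so its pairing with f
    - E f sees only the difference of the two expectations. Cauchy-Schwarz bounds this difference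
    below, and Pythagoras turns it into energy. *)
Lemma energy_increment b (c : code R X) (c' : code R Y) g h theta : 0 <= theta ->
  in_ball P b 1 g -> in_ball P' b 1 h ->
  theta < form_err P P' (clabel c) (clabel c')
            (fun x => disc (g x)) f (fun y => disc (h y)) ->
  exists d d', [/\ cost_le b P d 12, cost_le b P' d' 12 &
    energy c c' + theta ^+ 2 < energy (code_join c d) (code_join c' d')].
Proof.
move=> th0 gb hb lt.
have [d [dc dm]] := disc_code gb; have [d' [dc' dm']] := disc_code hb.
exists d, d'; split => //.
set c2 := code_join c d; set c2' := code_join c' d'.
set a := tens (fun x => disc (g x)) (fun y => disc (h y)).
pose D z := bcexp P P' (clabel c2) (clabel c2') f z - bcexp P P' (clabel c) (clabel c') f z.
have am : measurable_for (pair_label (clabel c2) (clabel c2')) a.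
  move=> [x y] [x' y'] e.
  have e1 : clabel c2 x = clabel c2 x' := f_equal fst e.
  have e2 : clabel c2' y = clabel c2' y' := f_equal snd e.
  rewrite /a /tens; congr (_ * conjc _); first exact: dm (join_refine_r e1).
  exact: dm' (join_refine_r e2).
have {}lt : theta < inner (prodp P P') a D.
  rewrite /D innerBr /bcexp -(cexp_adj _ (pair_label (clabel c2) _)).
  rewrite (@eq_inner _ _ _ _ a _ (unc f)) //; last by move=> z Pz; apply: cexp_id.
  by move: lt; rewrite form_errE -/a innerBr.
have a1 : inner (prodp P P') a a <= 1.
  rewrite tens_norm -[1]mulr1 ler_pM ?inner_ge0 //.
    exact: in_ball_L2 (in_ball_disc gb).
  exact: in_ball_L2 (in_ball_disc hb).
have := cexp_energy (prodp P P')
  (l1 := pair_label (clabel c) (clabel c')) (l2 := pair_label (clabel c2) (clabel c2')).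
move=> /(_ _ (unc f)) H.
have {}H : inner (prodp P P') D D = energy c2 c2' - energy c c'.
  apply: H => [[x y] [x' y']] e.
  have e1 : clabel c2 x = clabel c2 x' := f_equal fst e.
  have e2 : clabel c2' y = clabel c2' y' := f_equal snd e.
  by rewrite /pair_label /= (join_refine_l e1) (join_refine_l e2).
have cs := inner_CS (prodp P P') a D.
have D0 := inner_ge0 (prodp P P') D.
suff : theta ^+ 2 < inner (prodp P P') D D by rewrite H; lra.
apply: (@lt_le_trans _ _ (inner (prodp P P') a D ^+ 2)).
  by rewrite ltr_pXn2r ?nnegrE // (le_trans th0 (ltW lt)).
by apply: le_trans cs _; rewrite ler_piMl.
Qed.

(** The energy bound is strict once J > 0. Strictness yields the final contradiction when M = 0,
    since then theta is 0 as well. *)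
Lemma energy_iteration b (theta : R) (J : nat) : 0 <= theta ->
  exists c c', [/\ cost_le b P c (12 * J%:R), cost_le b P' c' (12 * J%:R) &
    reg_bound P P' (clabel c) (clabel c') b f (4 * theta) \/
    J%:R * theta ^+ 2 < energy c c' ?<= if ~~ (0 < J)%N].
Proof.
move=> th0; elim: J => [|J [c [c' [cc cc' IH]]]].
  exists (code_trivial R X), (code_trivial R Y); rewrite mulr0.
  by split; [exact: cost_trivial | exact: cost_trivial | right; rewrite mul0r; exact: inner_ge0].
have JE : J.+1%:R = J%:R + 1 :> R by rewrite natr1.
have JS : 12 * J%:R <= 12 * J.+1%:R :> R by rewrite ler_pM2l // ler_nat.
have [rb|nrb] := EM (reg_bound P P' (clabel c) (clabel c') b f (4 * theta)).
  exists c, c'; split; [exact: cost_leW cc | exact: cost_leW cc' | by left].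
have {IH} le_e : J%:R * theta ^+ 2 <= energy c c'.
  by case: IH => // /lteifW.
have [g [h [gb hb lt]]] : exists g h, [/\ in_ball P b 1 g, in_ball P' b 1 h &
    theta < form_err P P' (clabel c) (clabel c')
            (fun x => disc (g x)) f (fun y => disc (h y))].
  apply: contrapT => H; apply: nrb; apply: reg_bound_disc => g h gb hb.
  by rewrite leNgt; apply/negP => lt; apply: H; exists g, h.
have [d [d' [dc dc' inc]]] := energy_increment th0 gb hb lt.
exists (code_join c d), (code_join c' d'); split.
- by rewrite JE mulrDr mulr1; apply: cost_join.
- by rewrite JE mulrDr mulr1; apply: cost_join.
- by right; rewrite /=; apply: le_lt_trans inc; rewrite JE; lra.
Qed.

Lemma regularity_frobenius b (M delta : R) : 0 <= M -> 0 < delta <= 1 ->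
  inner (prodp P P') (unc f) (unc f) <= M ^+ 2 ->
  exists c c', [/\ cost_le b P c (204 * (delta ^+ 2)^-1),
    cost_le b P' c' (204 * (delta ^+ 2)^-1) &
    reg_bound P P' (clabel c) (clabel c') b f (delta * M)].
Proof.
move=> M0 /andP[d0 d1] fM.
(* Each round gains more than (delta M / 4)^2 and the energy stays below M^2, so 16 / delta^2 rounds
   suffice. As delta <= 1, rounding up gives J <= 17 / delta^2, and 12 * 17 = 204. *)
pose J := (Num.truncn (16 / delta ^+ 2)).+1.
have d2 : 0 < delta ^+ 2 by rewrite exprn_gt0.
have id2 : 1 <= (delta ^+ 2)^-1 by rewrite invf_ge1 // exprn_ile1 // ltW.
have J_gt : 16 / delta ^+ 2 < J%:R by apply: truncnS_gt.
have J_le : J%:R <= 17 * (delta ^+ 2)^-1.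
  rewrite /J -[X in X <= _]natr1; have := truncn_le (16 / delta ^+ 2).
  by rewrite (divr_ge0 _ (ltW d2)) // => ?; lra.
have [c [c' [cc cc' H]]] := @energy_iteration b (delta * M / 4) J
  (divr_ge0 (mulr_ge0 (ltW d0) M0) (ler0n _ 4)).
have J204 : 12 * J%:R <= 204 * (delta ^+ 2)^-1 by lra.
exists c, c'; split; [exact: cost_leW cc | exact: cost_leW cc' |].
case: H; first by have -> : 4 * (delta * M / 4) = delta * M by field.
rewrite /= => lt; exfalso.
have := lt_le_trans lt (le_trans (energy_le c c') fM).
have : 16 <= J%:R * delta ^+ 2 by rewrite -ler_pdivrMr // ltW.
by have := sqr_ge0 M; rewrite !exprMn; nra.
Qed.

End FrobeniusRegularity.

(** * Refinement, and reduction to the Gram kernels *)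

Section Gram.
Local Open Scope complex_scope.
Variable R : realType.

Section Refinement.
Variables (X Y : finType) (P : finprob R X) (P' : finprob R Y).
Variables (L L' K K' : eqType) (l : X -> L) (l' : Y -> L') (k : X -> K) (k' : Y -> K').

(** With E coarse and E' fine, f - E' f = (f - E f) - E' (f - E f); the second term amounts to
    averaging the test functions, which stay in their balls. *)
Lemma reg_bound_refine b f N :
  (forall x y, k x = k y -> l x = l y) -> (forall x y, k' x = k' y -> l' x = l' y) ->
  reg_bound P P' l l' b f N -> reg_bound P P' k k' b f (2 * N).
Proof.
move=> kl kl' H g h gb hb.
have e : form_err P P' k k' g f h = form_err P P' l l' g f h
           - form_err P P' l l' (cexp P k g) f (cexp P' k' h).
  rewrite !form_errE.
  have -> : inner (prodp P P') (tens (cexp P k g) (cexp P' k' h))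
      (fun z => unc f z - bcexp P P' l l' f z) =
      inner (prodp P P') (tens g h)
        (fun z => bcexp P P' k k' f z - bcexp P P' l l' f z).
    transitivity (inner (prodp P P') (cexp (prodp P P') (pair_label k k') (tens g h))
      (fun z => unc f z - bcexp P P' l l' f z)).
      by apply: eq_inner => // z _; exact/esym/cexp_tens.
    rewrite cexp_adj; apply: eq_inner => // z Pz.
    rewrite cexpB; congr (_ - _); apply: cexp_refine_l => // -[x y] [x' y'] [e1 e2].
    by rewrite /pair_label /= (kl _ _ e1) (kl' _ _ e2).
  by rewrite !innerBr; ring.
rewrite e.
have := H _ _ gb hb.
(* The bound is one-sided, so the subtracted term is tested at the opposite function. *)
have : form_err P P' l l' (fun x => (-1)%:C * cexp P k g x) f (cexp P' k' h) <= N.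
  apply: H; last exact: in_ball_cexp.
  have := in_ballZ (-1) (in_ball_cexp k gb).
  by rewrite sqrrN expr1n mul1r.
by rewrite form_errZl; lra.
Qed.

End Refinement.

Section Adjoint.
Variables (X Y : finType) (P : finprob R X) (P' : finprob R Y).
Implicit Types (f : X -> Y -> R[i]) (g w : X -> R[i]) (h : Y -> R[i]).

Definition adj f (y : Y) (x : X) : R[i] := conjc (f x y).

(** The kernel of f f^*; [adj_ap g f] is the function f^* g. *)
Definition gram f (x x' : X) : R[i] := \sum_y (P' y)%:C * (f x y * conjc (f x' y)).

Definition adj_ap g f (y : Y) : R[i] := \sum_x (P x)%:C * (g x * conjc (f x y)).

Lemma form_sumE g f h :
  form P P' g f h = \sum_x \sum_y P x * P' y * dotc (g x * conjc (h y)) (f x y).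
Proof.
by rewrite /form /inner -(pair_big predT predT
  (fun x y => P x * P' y * dotc (g x * conjc (h y)) (f x y))).
Qed.

Lemma form_adj_ap g f h : form P P' g f h = inner P' (adj_ap g f) h.
Proof.
rewrite form_sumE exchange_big; apply: eq_bigr => y _ /=.
rewrite dotc_suml mulr_sumr; apply: eq_bigr => x _; rewrite dotcZl.
move: (g x) (h y) (f x y) => [? ?] [? ?] [? ?]; rewrite /dotc /=; ring.
Qed.

Lemma form_gram w f : form P P w (gram f) w = inner P' (adj_ap w f) (adj_ap w f).
Proof.
rewrite /form /inner -(pair_big predT predT
  (fun x y => P x * P y * dotc (w x * conjc (w y)) (gram f x y))) /=.
under [RHS]eq_bigr => y _.
  rewrite dotc_suml mulr_sumr.
  under eq_bigr => x _ do rewrite dotc_sumr mulr_sumr.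
  over.
rewrite [RHS]exchange_big; apply: eq_bigr => x _ /=.
rewrite [RHS]exchange_big; apply: eq_bigr => x' _ /=.
rewrite dotc_sumr mulr_sumr; apply: eq_bigr => y _.
rewrite dotcZr dotcZl dotcZr.
move: (w x) (w x') (f x y) (f x' y) => [? ?] [? ?] [? ?] [? ?]; rewrite /dotc /=; ring.
Qed.

End Adjoint.

Lemma form_adj (X Y : finType) (P : finprob R X) (P' : finprob R Y) g (f : X -> Y -> R[i]) h :
  form P' P h (adj f) g = form P P' g f h.
Proof.
rewrite !form_sumE exchange_big; apply: eq_bigr => x _; apply: eq_bigr => y _ /=.
rewrite /adj.
move: (g x) (h y) (f x y) => [? ?] [? ?] [? ?]; rewrite /dotc /=; ring.
Qed.

(* With w = g - E g, the form of f f^* at (w, w) is |f^* w|^2 and equals its own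
   error term, as E w = 0. *)
Lemma form_residual (X Y : finType) (P : finprob R X) (P' : finprob R Y)
    (L : eqType) (l : X -> L) b (f : X -> Y -> R[i]) (s : R) g h : 0 <= s ->
  reg_bound P P l l b (gram P' f) (s ^+ 2) -> in_ball P b 1 g -> in_ball P' b 1 h ->
  form P P' (fun x => g x - cexp P l g x) f h <= 2 * s.
Proof.
move=> s0 H gb hb; set w := fun x => _.
have wb : in_ball P b (2 ^+ 2) w.
  have := in_ballB gb (in_ball_cexp l gb); rewrite mulr1.
  by have -> : 2 ^+ 2 = 4 :> R by ring.
have Ew : form P P (cexp P l w) (gram P' f) (cexp P l w) = 0.
  rewrite form_gram /inner big1 // => y _.
  have -> : adj_ap P (cexp P l w) f y = 0; last by rewrite dotc0l mulr0.
  rewrite /adj_ap big1 // => x _.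
  have [->|Px] := eqVneq (P x) 0; first by rewrite mul0r.
  rewrite cexpB (@cexp_id _ _ _ _ _ (cexp P l g)) //; last exact: cexp_measurable.
  by rewrite subrr mul0r mulr0.
(* As a difference of two functions in the unit ball, w has radius 2; hence |f^* w|^2 <= 2 * 2 *
   s^2. *)
have := reg_boundZ (ltr0Sn R 1) (ltr0Sn R 1) H wb wb.
rewrite /form_err Ew subr0 form_gram => n2.
rewrite form_adj_ap -[2 * s]mulr1; apply: inner_le => //.
- by rewrite mulr_ge0.
- by apply: le_trans n2 _; rewrite exprMn; lra.
- by rewrite expr1n; apply: in_ball_L2 hb.
Qed.

(** Replace g by E g, then h by E h. Each change costs at most 2 s, the second one being read on f^*
    with E g still in the ball. *)
Lemma reg_bound_gram (X Y : finType) (P : finprob R X) (P' : finprob R Y)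
    (L L' : eqType) (l : X -> L) (l' : Y -> L') b (f : X -> Y -> R[i]) (s : R) : 0 <= s ->
  reg_bound P P l l b (gram P' f) (s ^+ 2) ->
  reg_bound P' P' l' l' b (gram P (adj f)) (s ^+ 2) ->
  reg_bound P P' l l' b f (4 * s).
Proof.
move=> s0 H H' g h gb hb.
have -> : form_err P P' l l' g f h = form P P' (fun x => g x - cexp P l g x) f h
   + form P' P (fun x => h x - cexp P' l' h x) (adj f) (cexp P l g).
  by rewrite /form_err form_adj formBl formBr; ring.
have := form_residual s0 H gb hb.
have := form_residual s0 H' hb (in_ball_cexp l gb); lra.
Qed.

End Gram.

(** * Schatten norms of exponent 2^(n+1) as traces, and the induction on n *)

Section Schatten.
Local Open Scope complex_scope.
Local Open Scope sesquilinear_scope.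
Variable R : realType.

Lemma conjCE (z : R[i]) : (Num.conj z : R[i]) = conjc z.
Proof. by []. Qed.

Section Weighted.
Variables (X Y : finType) (P : finprob R X) (P' : finprob R Y).
Variable f : X -> Y -> R[i].
Local Notation W := (weighted_mx P P' f).

Lemma weighted_adj : weighted_mx P' P (adj f) = W ^t*.
Proof.
apply/matrixP => a b; rewrite !mxE conjCE [in RHS]mulrC conjcZ mulrC.
by rewrite (mulrC (P _)).
Qed.

Lemma weighted_gram : weighted_mx P P (gram P' f) = W *m W ^t*.
Proof.
apply/matrixP => a b; rewrite !mxE /gram mulr_suml.
rewrite (reindex (@enum_val Y predT)) /=; last first.
  by exists enum_rank => y _; rewrite ?enum_valK ?enum_rankK.
apply: eq_bigr => j _; rewrite !mxE conjCE (mulrC (f _ _) (Num.sqrt (P (enum_val b) * _))%:C) conjcZ.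
rewrite !sqrtrM ?pmf_ge0 // !rmorphM /=.
set p' := P' _; have -> : p'%:C = (Num.sqrt p')%:C * (Num.sqrt p')%:C.
  by rewrite -rmorphM /= -expr2 sqr_sqrtr ?pmf_ge0.
ring.
Qed.

Lemma inner_trace : inner (prodp P P') (unc f) (unc f) = complex.Re (\tr (W ^t* *m W)).
Proof.
rewrite /inner -(pair_big predT predT (fun x y => P x * P' y * dotc (f x y) (f x y))) /=.
rewrite exchange_big /mxtrace Re_sum (reindex (@enum_val Y predT)) /=; last first.
  by exists enum_rank => y _; rewrite ?enum_valK ?enum_rankK.
apply: eq_bigr => j _; rewrite mxE Re_sum (reindex (@enum_val X predT)) /=; last first.
  by exists enum_rank => y _; rewrite ?enum_valK ?enum_rankK.
apply: eq_bigr => i _; rewrite !mxE conjCE -dotcE !(mulrC (f _ _)) dotcZl dotcZr mulrA.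
by rewrite -expr2 sqr_sqrtr // mulr_ge0 ?pmf_ge0.
Qed.

End Weighted.

Lemma mx_exp_shift (n m : nat) (A : 'M[R[i]]_(m, n)) (B : 'M[R[i]]_(n, m)) (k : nat) :
  (A *m B : 'M_m) ^+ k.+1 = A *m ((B *m A : 'M_n) ^+ k *m B).
Proof.
elim: k => [|k IH]; first by rewrite expr0 expr1 mul1mx.
by rewrite exprS IH [in RHS]exprS -!mulmxE !mulmxA.
Qed.

(** Cyclicity between different sizes; at exponent 0 the two sides would be m and n. *)
Lemma trace_exp_swap (n m : nat) (A : 'M[R[i]]_(m, n)) (B : 'M[R[i]]_(n, m)) (k : nat) :
  \tr ((A *m B : 'M_m) ^+ k.+1) = \tr ((B *m A : 'M_n) ^+ k.+1).
Proof. by rewrite mx_exp_shift mxtrace_mulC [in RHS]exprSr -mulmxE mulmxA. Qed.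

(** The S^(2^(n+1)) norm of f, raised to the power 2^(n+1). As a trace it passes to f f^* and to f^*
    by cyclicity alone. *)
Definition schatten_pow (X Y : finType) (P : finprob R X) (P' : finprob R Y)
    (f : X -> Y -> R[i]) (n : nat) : R :=
  complex.Re (\tr ((weighted_mx P P' f ^t* *m weighted_mx P P' f : 'M_#|Y|) ^+ (2 ^ n))).

Lemma trmxC_mul (m n p : nat) (A : 'M[R[i]]_(m, n)) (B : 'M[R[i]]_(n, p)) :
  (A *m B) ^t* = B ^t* *m A ^t*.
Proof. by rewrite trmx_mul map_mxM. Qed.

Lemma schatten_pow_gram (X Y : finType) (P : finprob R X) (P' : finprob R Y)
    (f : X -> Y -> R[i]) n :
  schatten_pow P P (gram P' f) n = schatten_pow P P' f n.+1.
Proof.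
rewrite /schatten_pow weighted_gram trmxC_mul trmxCK mulmxE -expr2 -exprM -expnS.
have -> : (2 ^ n.+1 = (2 ^ n.+1).-1.+1)%N by rewrite prednK // expn_gt0.
by rewrite trace_exp_swap.
Qed.

Lemma schatten_pow_adj (X Y : finType) (P : finprob R X) (P' : finprob R Y)
    (f : X -> Y -> R[i]) n :
  schatten_pow P' P (adj f) n = schatten_pow P P' f n.
Proof.
rewrite /schatten_pow weighted_adj trmxCK.
have -> : (2 ^ n = (2 ^ n).-1.+1)%N by rewrite prednK // expn_gt0.
by rewrite trace_exp_swap.
Qed.

Theorem regularity (n : nat) : exists2 C : R, 0 <= C &
  forall (X Y : finType) (P : finprob R X) (P' : finprob R Y) (f : X -> Y -> R[i])
    (b : bool) (M delta : R), 0 <= M -> 0 < delta <= 1 ->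
  schatten_pow P P' f n <= M ^+ (2 ^ n.+1) ->
  exists c c', [/\ cost_le b P c (C * (delta ^+ (2 ^ n.+1))^-1),
    cost_le b P' c' (C * (delta ^+ (2 ^ n.+1))^-1) &
    reg_bound P P' (clabel c) (clabel c') b f (delta * M)].
Proof.
elim: n => [|n [C C0 IH]].
  exists 204 => // X Y P P' f b M delta M0 d01 fM.
  by apply: regularity_frobenius => //; rewrite inner_trace.
exists (2 * C * 32 ^+ (2 ^ n.+1)).
  by rewrite !mulr_ge0 ?exprn_ge0.
move=> X Y P P' f b M delta M0 /andP[d0 d1] fM.
(* The factor 4 of [reg_bound_gram] asks for error delta^2 M^2 / 16 on the Gram kernels; joining
   codes below loses a further factor 2. *)
pose d' := delta ^+ 2 / 32.
have d2 : 0 < delta ^+ 2 by rewrite exprn_gt0.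
have d2' : delta ^+ 2 <= 1 by rewrite exprn_ile1 // ltW.
have d'01 : 0 < d' <= 1 by apply/andP; split; rewrite /d'; lra.
have step (Z V : finType) (Q : finprob R Z) (Q' : finprob R V) (k : Z -> V -> R[i]) :
    schatten_pow Q Q' k n.+1 <= M ^+ (2 ^ n.+2) -> exists c : code R Z,
    cost_le b Q c (2 * C * 32 ^+ (2 ^ n.+1) * (delta ^+ (2 ^ n.+2))^-1) /\
    reg_bound Q Q (clabel c) (clabel c) b (gram Q' k) ((delta * M / 4) ^+ 2).
  move=> kM; have := IH Z Z Q Q (gram Q' k) b (M ^+ 2) d' (sqr_ge0 M) d'01.
  rewrite schatten_pow_gram -exprM -expnS => /(_ kM) [c [c' [cc cc' H]]].
  (* The induction hypothesis returns one partition for the rows and another for the columns of the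
     Gram kernel, while [reg_bound_gram] asks for the same on both sides. *)
  exists (code_join c c'); split.
    have -> : 2 * C * 32 ^+ (2 ^ n.+1) * (delta ^+ (2 ^ n.+2))^-1 =
      C * (d' ^+ (2 ^ n.+1))^-1 + C * (d' ^+ (2 ^ n.+1))^-1.
      rewrite /d' expr_div_n -exprM -expnS.
      have : delta ^+ (2 ^ n.+2) != 0 by rewrite expf_neq0 ?gt_eqF.
      have : 32 ^+ (2 ^ n.+1) != 0 :> R by rewrite expf_neq0 ?pnatr_eq0.
      by move: (delta ^+ _) (32 ^+ _) => u v v0 u0; field; rewrite u0 v0.
    exact: cost_join.
  have -> : (delta * M / 4) ^+ 2 = 2 * (d' * M ^+ 2) by rewrite /d'; field.
  apply: reg_bound_refine H; [exact: join_refine_l | exact: join_refine_r].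
have [c [cc H]] := step _ _ _ _ _ fM.
have := fM; rewrite -schatten_pow_adj => /step [c' [cc' H']].
exists c, c'; split => //.
have -> : delta * M = 4 * (delta * M / 4) by field.
apply: reg_bound_gram => //.
by rewrite divr_ge0 // mulr_ge0 // ltW.
Qed.

End Schatten.

(** * Singular values through the spectral theorem *)

Section SingularValues.
Local Open Scope complex_scope.
Local Open Scope sesquilinear_scope.
Variable R : realType.

Definition nrm2 (n : nat) (v : 'cV[R[i]]_n) : R := \sum_i dotc (v i 0) (v i 0).

Lemma nrm2_ge0 n (v : 'cV[R[i]]_n) : 0 <= nrm2 v.
Proof. by apply: sumr_ge0 => i _; apply: dotc_ge0. Qed.

Lemma nrm2E n (v : 'cV[R[i]]_n) : nrm2 v = complex.Re ((v ^t* *m v) 0 0).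
Proof.
by rewrite mxE Re_sum; apply: eq_bigr => i _; rewrite !mxE conjCE -dotcE.
Qed.

Lemma nrm2_real n (v : 'cV[R[i]]_n) : complex.Im ((v ^t* *m v) 0 0) = 0.
Proof.
rewrite mxE Im_sum big1 // => i _; rewrite !mxE conjCE.
by case: (v i 0) => a b /=; ring.
Qed.

Lemma dotc_eq0 (a : R[i]) : dotc a a = 0 -> a = 0.
Proof.
case: a => a b; rewrite /dotc /= => /eqP.
by rewrite -!expr2 paddr_eq0 ?sqr_ge0 // !sqrf_eq0 => /andP[/eqP-> /eqP->].
Qed.

Lemma nrm2_eq0 n (v : 'cV[R[i]]_n) : nrm2 v = 0 -> v = 0.
Proof.
move=> /eqP; rewrite psumr_eq0 => [/allP v0|i _]; last exact: dotc_ge0.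
apply/matrixP => i j; rewrite (ord1 j) mxE; apply: dotc_eq0.
by apply/eqP; apply: v0; rewrite mem_index_enum.
Qed.

Section Spectral.
Variables (m n : nat) (A : 'M[R[i]]_(m, n)).
Local Notation G := (A ^t* *m A).
Local Notation U := (spectralmx G).
Local Notation d := (spectral_diag G).
Local Notation sv := (singular_values A).

Lemma gram_spectral : G = U ^t* *m diag_mx d *m U.
Proof.
have -> : U ^t* = invmx U by rewrite invmx_unitary ?spectral_unitarymx.
apply/orthomx_spectralP/normalmxP.
by rewrite trmxC_mul trmxCK.
Qed.

Lemma spectral_unitaryl : U *m U ^t* = 1%:M.
Proof. exact/unitarymxP/spectral_unitarymx. Qed.

Lemma spectral_unitaryr : U ^t* *m U = 1%:M.
Proof. by rewrite -invmx_unitary ?spectral_unitarymx // mulVmx ?spectral_unit. Qed.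

Lemma nrm2_spectral (v : 'cV[R[i]]_n) : nrm2 (U *m v) = nrm2 v.
Proof.
by rewrite !nrm2E trmxC_mul mulmxA -(mulmxA (v ^t*)) spectral_unitaryr mulmx1.
Qed.

Lemma gram_form_spectral (v : 'cV[R[i]]_n) : ((A *m v) ^t* *m (A *m v)) 0 0 =
  \sum_j d 0 j * (dotc ((U *m v) j 0) ((U *m v) j 0))%:C.
Proof.
have -> : (A *m v) ^t* *m (A *m v) = (U *m v) ^t* *m (diag_mx d *m (U *m v)).
  by rewrite !trmxC_mul !mulmxA -(mulmxA (v ^t*)) {1}gram_spectral !mulmxA.
move: (U *m v) => w.
rewrite mxE; apply: eq_bigr => j _; rewrite mul_diag_mx !mxE conjCE.
rewrite mulrCA; congr (_ * _).
by case: (w j 0) => a b; rewrite /dotc; apply/eqP; rewrite eq_complex /=; apply/andP; split; apply/eqP; ring.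
Qed.

Lemma nrm2_gram (v : 'cV[R[i]]_n) : nrm2 (A *m v) =
  \sum_j complex.Re (d 0 j) * dotc ((U *m v) j 0) ((U *m v) j 0).
Proof.
rewrite nrm2E gram_form_spectral Re_sum; apply: eq_bigr => j _.
by case: (d 0 j) => a b /=; ring.
Qed.

Definition singular_vector (j : 'I_n) : 'cV[R[i]]_n := U ^t* *m delta_mx j 0.

Lemma spectral_singular_vector j : U *m singular_vector j = delta_mx j 0.
Proof. by rewrite mulmxA spectral_unitaryl mul1mx. Qed.

Lemma dotc_delta (j k : 'I_n) :
  dotc ((delta_mx j 0 : 'cV[R[i]]_n) k 0) ((delta_mx j 0 : 'cV[R[i]]_n) k 0) = (k == j)%:R.
Proof. by rewrite mxE eqxx andbT /dotc; case: eqP => _ /=; ring. Qed.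

Lemma nrm2_singular_vector j : nrm2 (singular_vector j) = 1.
Proof.
rewrite -nrm2_spectral spectral_singular_vector /nrm2.
under eq_bigr do rewrite dotc_delta.
by rewrite (bigD1 j) //= eqxx big1 ?addr0 // => i /negPf ->.
Qed.

Lemma nrm2_mul_singular_vector j : nrm2 (A *m singular_vector j) = complex.Re (d 0 j).
Proof.
rewrite nrm2_gram; under eq_bigr do rewrite spectral_singular_vector dotc_delta.
by rewrite (bigD1 j) //= eqxx mulr1 big1 ?addr0 // => i /negPf ->; rewrite mulr0.
Qed.

(** The diagonal is a priori complex; its entry j is the value of |A v|^2 at a singular vector, thus
    real. *)
Lemma spectral_diag_re j : d 0 j = (complex.Re (d 0 j))%:C.
Proof.
have := gram_form_spectral (singular_vector j).
rewrite (bigD1 j) //= spectral_singular_vector dotc_delta eqxx mulr1.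
rewrite big1 => [|i /negPf ij]; last by rewrite dotc_delta ij mulr0.
move=> /(congr1 (@complex.Im R)); rewrite nrm2_real addr0.
by case: (d 0 j) => a b /= <-.
Qed.

Lemma spectral_diag_ge0 j : 0 <= complex.Re (d 0 j).
Proof. by rewrite -nrm2_mul_singular_vector nrm2_ge0. Qed.

Lemma singular_value_sqr j : sv 0 j ^+ 2 = complex.Re (d 0 j).
Proof. by rewrite mxE sqr_sqrtr ?spectral_diag_ge0. Qed.

Lemma singular_value_ge0 j : 0 <= sv 0 j.
Proof. by rewrite mxE sqrtr_ge0. Qed.

Lemma gram_exp_spectral k : G ^+ k = U ^t* *m (diag_mx d) ^+ k *m U.
Proof.
elim: k => [|k IH]; first by rewrite !expr0 mulmx1 spectral_unitaryr.
rewrite exprS IH [in RHS]exprS -!mulmxE {1}gram_spectral !mulmxA.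
by rewrite -(mulmxA _ U (U ^t*)) spectral_unitaryl mulmx1.
Qed.

Lemma trace_gram_exp k : complex.Re (\tr (G ^+ k)) = \sum_j sv 0 j ^+ (2 * k).
Proof.
rewrite gram_exp_spectral mxtrace_mulC mulmxA spectral_unitaryl mul1mx.
have -> : (diag_mx d) ^+ k = diag_mx (\row_j d 0 j ^+ k).
  elim: k => [|k IH].
    by apply/matrixP => i j; rewrite expr0 !mxE expr0.
  rewrite exprS IH -mulmxE mul_diag_mx; apply/matrixP => i j; rewrite !mxE exprS.
  by rewrite mulrnAr.
rewrite mxtrace_diag Re_sum; apply: eq_bigr => j _.
by rewrite mxE spectral_diag_re -rmorphXn /= exprM singular_value_sqr.
Qed.

Lemma singular_value_le N j : 0 <= N ->
  (forall v, nrm2 (A *m v) <= N ^+ 2 * nrm2 v) -> sv 0 j <= N.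
Proof.
move=> N0 AN; rewrite -(@ler_pXn2r _ 2) ?nnegrE ?singular_value_ge0 //.
rewrite singular_value_sqr -nrm2_mul_singular_vector.
by apply: le_trans (AN _) _; rewrite nrm2_singular_vector mulr1.
Qed.

(** With [nrm2_mul_gt], the two halves of the min-max principle: an upper bound on the span of the
    directions with singular value at most t, a strict lower bound on the span of the others. *)
Lemma nrm2_mul_le t v : 0 <= t ->
  (forall j, t < sv 0 j -> (U *m v) j 0 = 0) -> nrm2 (A *m v) <= t ^+ 2 * nrm2 v.
Proof.
move=> t0 H; rewrite nrm2_gram -nrm2_spectral mulr_sumr; apply: ler_sum => j _.
have [/H ->|tj] := ltP t (sv 0 j); first by rewrite dotc0l !mulr0.
rewrite -singular_value_sqr ler_wpM2r ?dotc_ge0 //.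
by rewrite ler_pXn2r ?nnegrE ?singular_value_ge0.
Qed.

Lemma nrm2_mul_gt t v : 0 <= t -> v != 0 ->
  (forall j, sv 0 j <= t -> (U *m v) j 0 = 0) -> t ^+ 2 * nrm2 v < nrm2 (A *m v).
Proof.
move=> t0 v0 H.
have [j vj] : exists j, (U *m v) j 0 != 0.
  apply/existsP; apply: contraR v0; rewrite negb_exists => /forallP vj.
  apply/eqP/nrm2_eq0; rewrite -nrm2_spectral /nrm2 big1 // => j _.
  by have := vj j; rewrite negbK => /eqP ->; rewrite dotc0l.
have sq i : t < sv 0 i -> t ^+ 2 < complex.Re (d 0 i).
  by move=> ti; rewrite -singular_value_sqr ltr_pXn2r ?nnegrE ?singular_value_ge0.
rewrite nrm2_gram -nrm2_spectral mulr_sumr (bigD1 j) //= [ltRHS](bigD1 j) //=.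
apply: ltr_leD.
  rewrite ltr_pM2r; last first.
    rewrite lt_neqAle dotc_ge0 andbT eq_sym; apply: contra vj => /eqP /dotc_eq0 ->.
    by rewrite eqxx.
  by apply: sq; rewrite ltNge; apply: contra vj => /H ->.
apply: ler_sum => i _.
have [/H ->|ti] := leP (sv 0 i) t; first by rewrite dotc0l !mulr0.
by rewrite ler_wpM2r ?dotc_ge0 // ltW // sq.
Qed.

End Spectral.

Lemma exists_in_kernel (F : fieldType) (p q : nat) (C : 'M[F]_(p, q)) :
  (q < p)%N -> exists2 x : 'rV[F]_p, x != 0 & x *m C = 0.
Proof.
move=> qp.
have : kermx C != 0.
  by rewrite -mxrank_eq0 mxrank_ker subn_eq0 -ltnNge (leq_ltn_trans (rank_leq_col C)).
move=> /rowV0Pn [x xk x0]; exists x => //; exact/sub_kermxP.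
Qed.

(* If B is at most the "sum" of A and A Q for a contraction Q, then on a vector v
   such that both v and Q v avoid the singular directions of A above t, B is at
   most 2 t; there is such a v in the span of any 2 #{s(A) > t} + 1 directions. *)
Lemma singular_value_count (m n : nat) (A B : 'M[R[i]]_(m, n)) (Q : 'M[R[i]]_n) (t : R) :
  0 <= t -> (forall v, nrm2 (B *m v) <= 2 * nrm2 (A *m v) + 2 * nrm2 (A *m (Q *m v))) ->
  (forall v, nrm2 (Q *m v) <= nrm2 v) ->
  (#|[set j | (2 * t < singular_values B 0 j)%R]| <=
   2 * #|[set j | (t < singular_values A 0 j)%R]|)%N.
Proof.
move=> t0 BA Qc; set JB := [set j | _]; set JA := [set j | _].
rewrite leqNgt; apply/negP => lt.
pose UA := spectralmx (A ^t* *m A); pose UB := spectralmx (B ^t* *m B).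
(* [UB ^t* *m E] parametrises the span of the directions of B above 2 t, and [T] reads coordinates
   along those of A above t. [C] collects 2 #|JA| conditions on v and Q v, fewer than the #|JB|
   unknowns. *)
pose E : 'M[R[i]]_(n, #|JB|) := \matrix_(i, k) (i == enum_val k)%:R.
pose T : 'M[R[i]]_(#|JA|, n) := \matrix_(k, i) UA (enum_val k) i.
pose C := col_mx (T *m (UB ^t* *m E)) (T *m (Q *m (UB ^t* *m E))).
have [|x x0 xC] := @exists_in_kernel _ _ _ C^T; first by rewrite addnn -mul2n.
have {}xC : C *m x^T = 0.
  by rewrite -[C *m _]trmxK trmx_mul trmxK xC trmx0.
pose v := UB ^t* *m E *m x^T.
have UBv : UB *m v = E *m x^T by rewrite /v !mulmxA spectral_unitaryl mul1mx.
have Tv : T *m v = 0 /\ T *m (Q *m v) = 0.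
  move: xC; rewrite mul_col_mx -[0]vsubmxK => /eq_col_mx [].
  by rewrite /v -!mulmxA !linear0.
have Tz (w : 'cV[R[i]]_n) : T *m w = 0 -> forall j, t < singular_values A 0 j -> (UA *m w) j 0 = 0.
  move=> Tw j tj; have jA : j \in JA by rewrite inE.
  have e : (T *m w) (enum_rank_in jA j) 0 = 0 by rewrite Tw mxE.
  rewrite -[RHS]e [LHS]mxE [RHS]mxE.
  by apply: eq_bigr => i _; rewrite !mxE enum_rankK_in.
have v0 : v != 0.
  apply: contra x0 => /eqP vz; move: UBv; rewrite vz mulmx0 => /esym Ex.
  apply/eqP/rowP => k; rewrite mxE.
  have : (E *m x^T) (enum_val k) 0 = 0 by rewrite Ex mxE.
  rewrite mxE (bigD1 k) //=.
  rewrite !mxE eqxx mul1r big1 ?addr0 // => i ik; rewrite !mxE.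
  by rewrite (inj_eq enum_val_inj) eq_sym (negPf ik) mul0r.
have Bz j : singular_values B 0 j <= 2 * t -> (UB *m v) j 0 = 0.
  move=> tj; rewrite UBv mxE big1 // => k _; rewrite !mxE.
  case: eqP => [jk|_]; last by rewrite mul0r.
  have := enum_valP k; rewrite -jk inE => /lt_geF; rewrite tj; by [].
have t2 : 0 <= 2 * t by rewrite mulr_ge0.
(* The contradiction is 4 t^2 |v|^2 < |B v|^2 <= 2 t^2 |v|^2 + 2 t^2 |Q v|^2 <= 4 t^2 |v|^2. *)
have := nrm2_mul_gt t2 v0 Bz.
have := nrm2_mul_le t0 (Tz _ Tv.1); have := nrm2_mul_le t0 (Tz _ Tv.2).
have := ler_wpM2l (sqr_ge0 t) (Qc v); have := BA v; rewrite exprMn.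
have -> : 2 ^+ 2 = 4 :> R by ring.
lra.
Qed.

End SingularValues.

(** * Power sums: comparison by counting, and interpolation *)

Section SchattenInterpolation.
Local Open Scope complex_scope.
Variable R : realType.

(** Match the maximum of u with an element of w at least as large, remove both and repeat: below
    that maximum both counts drop by one, and from it on u has nothing left. *)
Lemma sum_le_of_count_le (phi : R -> R) (u w : seq R) : phi 0 = 0 ->
  {in Num.nneg &, {homo phi : x y / x <= y}} ->
  {subset u <= Num.nneg} -> {subset w <= Num.nneg} ->
  (forall t, 0 <= t -> (count (> t) u <= count (> t) w)%N) ->
  \sum_(x <- u) phi x <= \sum_(x <- w) phi x.
Proof.
move=> phi0 phi_mono.
have phi_ge0 x : x \is Num.nneg -> 0 <= phi x.
  by move=> x0; rewrite -phi0 phi_mono // nnegrE.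
have [N] := ubnP (size u); elim: N u w => // N IH u w sN u0 w0 uw.
have sum_ge0 (s : seq R) : {subset s <= Num.nneg} -> 0 <= \sum_(x <- s) phi x.
  by move=> s0; rewrite big_seq; apply: sumr_ge0 => x /s0 /phi_ge0.
have [/hasP [a au a0]|/hasPn nu] := boolP (has (> 0) u); last first.
  rewrite big_seq big1 => [|x xu]; first exact: sum_ge0.
  have := nu x xu; have := u0 x xu; rewrite nnegrE -leNgt => x0 x0'.
  by rewrite (_ : x = 0) //; apply/eqP; rewrite eq_le x0 x0'.
pose m := \big[Num.max/0]_(x <- u) x.
have mu : forall x, x \in u -> x <= m by move=> x xu; apply: le_bigmax_seq.
have m0 : 0 < m by apply: lt_le_trans a0 (mu _ au).
have m_in : m \in u.
  have [//|] : m \in u \/ m = 0.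
    rewrite /m; elim: (u) => [|y s IHs]; first by rewrite big_nil; right.
    rewrite big_cons /Num.max; case: ifP => _.
      by case: IHs => [i|->]; [left; rewrite in_cons i orbT|right].
    by left; rewrite mem_head.
  by move=> mz; rewrite mz ltxx in m0.
(* Otherwise the counts above the maximum of w contradict the hypothesis. *)
have [b bw mb] : exists2 b, b \in w & m <= b.
  apply/hasP; apply/negP => /negP /hasPn nw.
  pose t := \big[Num.max/0]_(x <- w) x.
  have t0 : 0 <= t by apply: bigmax_ge_id.
  have tm : t < m.
    rewrite /t big_seq; elim/big_ind: _ => // [x y xm ym|x /nw]; last by rewrite -ltNge.
    by rewrite gt_max xm ym.
  have := uw t t0; rewrite [X in (_ <= X)%N](_ : _ = 0%N); last first.
    apply/eqP; rewrite -leqn0 leqNgt -has_count; apply/hasPn => x xw.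
    by rewrite -leNgt; apply: le_bigmax_seq.
  by rewrite leqn0 eqn0Ngt -has_count => /hasP; apply; exists m.
have pu := perm_to_rem m_in; have pw := perm_to_rem bw.
rewrite (perm_big _ pu) (perm_big _ pw) !big_cons lerD //.
  exact: phi_mono (u0 _ m_in) (w0 _ bw) mb.
apply: IH.
- by move: sN; rewrite (perm_size pu) /= ltnS.
- by move=> x /mem_rem; apply: u0.
- by move=> x /mem_rem; apply: w0.
move=> t t0; have [tm|mt] := ltP t m.
  have := uw t t0; rewrite (permP pu) (permP pw) /= tm (lt_le_trans tm mb).
  by rewrite !add1n ltnS.
rewrite [X in (X <= _)%N](_ : _ = 0%N) //.
apply/eqP; rewrite -leqn0 leqNgt -has_count; apply/hasPn => x /mem_rem /mu xm.
by rewrite -leNgt (le_trans xm mt).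
Qed.

Lemma powR_le_split (x K p q : R) : 0 <= x <= K -> 0 < q <= p ->
  x `^ p <= x `^ q * K `^ (p - q).
Proof.
move=> /andP[x0 xK] /andP[q0 qp].
have [->|xn] := eqVneq x 0.
  by rewrite powR0 ?gt_eqF ?(lt_le_trans q0 qp) // powR0 ?gt_eqF // mul0r.
have -> : x `^ p = x `^ q * x `^ (p - q).
  by rewrite -powRD ?xn ?implybT // subrKC.
rewrite ler_wpM2l ?powR_ge0 //.
by apply: ge0_ler_powR; rewrite ?nnegrE ?subr_ge0 // (le_trans x0 xK).
Qed.

Section Lnorm.
Variables (n : nat) (s : 'rV[R]_n).
Hypothesis s0 : forall j, 0 <= s 0 j.

Lemma sum_powR_ge0 q : 0 <= \sum_j s 0 j `^ q.
Proof. by apply: sumr_ge0 => j _; apply: powR_ge0. Qed.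

Lemma lnorm_leP (q M : R) : 0 < q -> 0 <= M ->
  (lnorm q%:E s <= M) = (\sum_j s 0 j `^ q <= M `^ q).
Proof.
move=> q0 M0; rewrite /lnorm; set S := \sum_j _.
have S0 : 0 <= S := sum_powR_ge0 q.
have e : (S `^ q^-1) `^ q = S by rewrite -powRrM mulVf ?gt_eqF // powRr1.
apply/idP/idP => H.
  by rewrite -e; apply: ge0_ler_powR; rewrite ?nnegrE ?powR_ge0 // ltW.
have -> : M = (M `^ q) `^ q^-1 by rewrite -powRrM mulfV ?gt_eqF // powRr1.
by apply: ge0_ler_powR; rewrite ?nnegrE ?powR_ge0 ?invr_ge0 // ltW.
Qed.

Lemma coord_le (q M : R) j : 0 < q -> 0 <= M ->
  \sum_j s 0 j `^ q <= M `^ q -> s 0 j <= M.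
Proof.
move=> q0 M0 H; rewrite leNgt; apply/negP => lt.
have : M `^ q < s 0 j `^ q by apply: gt0_ltr_powR; rewrite ?nnegrE.
apply/negP; rewrite -leNgt; apply: le_trans H.
by rewrite (bigD1 j) //= lerDl; apply: sumr_ge0 => i _; apply: powR_ge0.
Qed.

Lemma sum_powR_interp (q p M K : R) : 0 < q <= p -> (forall j, s 0 j <= K) ->
  \sum_j s 0 j `^ q <= M -> \sum_j s 0 j `^ p <= M * K `^ (p - q).
Proof.
move=> qp sK H; apply: (@le_trans _ _ (\sum_j s 0 j `^ q * K `^ (p - q))).
  by apply: ler_sum => j _; apply: powR_le_split => //; rewrite s0 sK.
by rewrite -mulr_suml ler_wpM2r ?powR_ge0.
Qed.

(** Monotonicity of l^p norms: interpolate with the bound M that the l^q norm itself puts on each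
    coordinate. *)
Lemma sum_exprn_le (q M : R) (N : nat) : 0 < q <= N%:R -> 0 <= M ->
  lnorm q%:E s <= M -> \sum_j s 0 j ^+ N <= M ^+ N.
Proof.
move=> qN M0; have /andP[q0 qN'] := qN; rewrite lnorm_leP // => H.
have := sum_powR_interp qN (fun j => coord_le j q0 M0 H) H.
have N0 : (N%:R : R) != 0 by rewrite gt_eqF // (lt_le_trans q0).
have -> : M `^ q * M `^ (N%:R - q) = M ^+ N.
  by rewrite -powRD ?subrKC ?powR_mulrn // (negPf N0).
by under eq_bigr do rewrite powR_mulrn //.
Qed.

End Lnorm.

Lemma sum_powR_count (n : nat) (u w : 'rV[R]_n) (q : R) : 0 < q ->
  (forall j, 0 <= u 0 j) -> (forall j, 0 <= w 0 j) ->
  (forall t : R, 0 <= t -> (#|[set j | (2 * t < u 0 j)%R]| <=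
     2 * #|[set j | (t < w 0 j)%R]|)%N) ->
  \sum_j u 0 j `^ q <= 2 * 2 `^ q * \sum_j w 0 j `^ q.
Proof.
move=> q0 u0 w0 uw.
(* Halving u and listing w twice turns the assumption into a plain comparison of counts. *)
pose su := [seq u 0 j / 2 | j : 'I_n]; pose sw := [seq w 0 j | j : 'I_n].
have cnt (a : pred R) (v : 'I_n -> R) : count a [seq v j | j : 'I_n] = #|[set j | a (v j)]|.
  rewrite count_map -size_filter cardsE cardE /enum_mem -filter_predI.
  by congr size; apply: eq_filter => j; rewrite !inE /= andbT.
have := @sum_le_of_count_le (fun x => x `^ q) su (sw ++ sw).
rewrite big_cat /= /su /sw !big_image /=.
have -> : \sum_j u 0 j `^ q = 2 `^ q * \sum_j (u 0 j / 2) `^ q.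
  rewrite mulr_sumr; apply: eq_bigr => j _.
  by rewrite -powRM ?divr_ge0 ?u0 //; congr (_ `^ _); field.
move=> H; rewrite -mulrA (mulrCA 2) ler_wpM2l ?powR_ge0 //.
rewrite mulr2n mulrDl mul1r; apply: H.
- by rewrite powR0 ?gt_eqF.
- by move=> x y x0 y0 xy; apply: ge0_ler_powR => //; apply: ltW.
- by move=> _ /mapP [j _ ->]; rewrite nnegrE divr_ge0.
- by move=> x; rewrite mem_cat orbb => /mapP [j _ ->]; rewrite nnegrE.
move=> t t0; rewrite count_cat addnn -mul2n !cnt.
apply: leq_trans (uw t t0); apply: subset_leq_card; apply/subsetP => j.
by rewrite !inE /= ltr_pdivlMr // mulrC.
Qed.

End SchattenInterpolation.

(** * The operator of a kernel, and its residual *)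

Section Operators.
Local Open Scope complex_scope.
Local Open Scope sesquilinear_scope.
Variable R : realType.

(** The isometry of L^2(P) into l^2 that turns the operator with kernel F into [weighted_mx]. *)
Definition wcol (X : finType) (P : finprob R X) (h : X -> R[i]) : 'cV[R[i]]_#|X| :=
  \col_b ((Num.sqrt (P (enum_val b)))%:C * h (enum_val b)).

(* Points of probability zero are sent to 0, as 0^-1 = 0. *)
Definition unwcol (X : finType) (P : finprob R X) (v : 'cV[R[i]]_#|X|) (x : X) : R[i] :=
  ((Num.sqrt (P x))^-1)%:C * v (enum_rank x) 0.

Lemma sum_enum_val (X : finType) (V : nmodType) (F : X -> V) :
  \sum_x F x = \sum_(b < #|X|) F (enum_val b).
Proof.
rewrite (reindex (@enum_val X predT)) //=.
by exists enum_rank => y _; rewrite ?enum_valK ?enum_rankK.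
Qed.

Lemma nrm2_wcol (X : finType) (P : finprob R X) h : nrm2 (wcol P h) = inner P h h.
Proof.
rewrite /inner sum_enum_val; apply: eq_bigr => b _; rewrite mxE dotcZl dotcZr mulrA.
by rewrite -expr2 sqr_sqrtr ?pmf_ge0.
Qed.

Lemma sqrt_unwcol (X : finType) (P : finprob R X) v x :
  (P x)%:C * unwcol P v x = (Num.sqrt (P x))%:C * v (enum_rank x) 0.
Proof.
rewrite /unwcol mulrA -rmorphM /=; congr (_%:C * _).
have [->|s0] := eqVneq (Num.sqrt (P x)) 0; first by rewrite invr0 mulr0.
by rewrite -{1}[P x]sqr_sqrtr ?pmf_ge0 // expr2 mulfK.
Qed.

(** Only an inequality, since coordinates at points of mass zero are lost. *)
Lemma inner_unwcol_le (X : finType) (P : finprob R X) v :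
  inner P (unwcol P v) (unwcol P v) <= nrm2 v.
Proof.
rewrite /inner sum_enum_val; apply: ler_sum => b _.
rewrite /unwcol dotcZl dotcZr enum_valK; set p := P _.
have [->|s0] := eqVneq (Num.sqrt p) 0.
  by rewrite invr0 mul0r mulr0 dotc_ge0.
rewrite -{1}[p]sqr_sqrtr ?pmf_ge0 //.
by rewrite le_eqVlt; apply/orP; left; apply/eqP; field.
Qed.

Section Kernel.
Variables (X Y : finType) (P : finprob R X) (P' : finprob R Y).
Implicit Types (f F : X -> Y -> R[i]).

Definition ap F (h : Y -> R[i]) (x : X) : R[i] := \sum_y (P' y)%:C * (F x y * h y).

Lemma form_ap g F h : form P P' g F h = inner P g (ap F h).
Proof.
rewrite form_sumE; apply: eq_bigr => x _; rewrite dotc_sumr mulr_sumr.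
apply: eq_bigr => y _; rewrite dotcZr mulrA; congr (_ * _).
by move: (g x) (h y) (F x y) => [? ?] [? ?] [? ?]; rewrite /dotc /=; ring.
Qed.

Lemma eq_ap F h h' : (forall y, (P' y)%:C * h y = (P' y)%:C * h' y) -> ap F h =1 ap F h'.
Proof.
move=> e x; apply: eq_bigr => y _.
by rewrite mulrCA e mulrCA.
Qed.

Lemma weighted_mulmx F v : weighted_mx P P' F *m v = wcol P (ap F (unwcol P' v)).
Proof.
apply/matrixP => a j; rewrite (ord1 j) !mxE /ap [in RHS]sum_enum_val mulr_sumr.
apply: eq_bigr => b _; rewrite !mxE [X in _ = _ * X]mulrCA sqrt_unwcol enum_valK.
by rewrite sqrtrM ?pmf_ge0 // rmorphM /=; ring.
Qed.

Section Labels.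
Variables (L L' : eqType) (l : X -> L) (l' : Y -> L').

Definition kcexp f (x : X) (y : Y) : R[i] := bcexp P P' l l' f (x, y).

Definition residual f (x : X) (y : Y) : R[i] := f x y - kcexp f x y.

Lemma form_err_residual g f h : form_err P P' l l' g f h = form P P' g (residual f) h.
Proof. by rewrite form_errE; apply: eq_inner => // -[x y]. Qed.

(** The pair kernel factors, so E acts on operators by a projection on each side. The outer one is
    dropped as a contraction; the inner one becomes the Q of [singular_value_count]. *)
Lemma ap_kcexp f h : ap (kcexp f) h =1 cexp P l (ap f (cexp P' l' h)).
Proof.
move=> x.
transitivity (\sum_y \sum_x' \sum_y' (P' y)%:C * ((cexp_ker P l x x' * P x')%:C *
   (P' y')%:C * (cexp_ker P' l' y' y)%:C * f x' y' * h y)).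
  apply: eq_bigr => y _; rewrite /kcexp /bcexp /cexp mulr_suml mulr_sumr.
  rewrite pair_big /=; apply: eq_bigr => -[x' y'] _ /=.
  rewrite cexp_ker_pair /= (cexp_kerC P' l' y) /unc !rmorphM /=; ring.
rewrite exchange_big [RHS]/cexp; apply: eq_bigr => x' _ /=.
rewrite /ap exchange_big mulr_sumr; apply: eq_bigr => y' _ /=.
rewrite /cexp !mulr_sumr; apply: eq_bigr => y _.
by rewrite !rmorphM /=; ring.
Qed.

Lemma nrm2_residual f v : nrm2 (weighted_mx P P' (residual f) *m v) <=
  2 * nrm2 (weighted_mx P P' f *m v) +
  2 * inner P (ap f (cexp P' l' (unwcol P' v))) (ap f (cexp P' l' (unwcol P' v))).
Proof.
rewrite !weighted_mulmx !nrm2_wcol; set h := unwcol P' v.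
set k := ap f (cexp _ _ _).
apply: (@le_trans _ _ (2 * inner P (ap f h) (ap f h) + 2 * inner P (cexp P l k) (cexp P l k))).
  rewrite /inner !mulr_sumr -big_split; apply: ler_sum => x _ /=.
  have -> : ap (residual f) h x = ap f h x + - cexp P l k x.
    have <- := ap_kcexp f h x; rewrite /ap -sumrB; apply: eq_bigr => y _.
    by rewrite /residual mulrBl mulrBr.
  apply: le_trans (ler_wpM2l (pmf_ge0 P x) (dotcD2 _ _)) _.
  by rewrite dotcNl (dotcC _ (- _)) dotcNl opprK; lra.
by rewrite lerD2l ler_pM2l ?cexp_contract.
Qed.

Definition cexp_mx : 'M[R[i]]_#|Y| := \matrix_(a, b)
  (cexp_ker P' l' (enum_val a) (enum_val b)
   * Num.sqrt (P' (enum_val a)) * Num.sqrt (P' (enum_val b)))%:C.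

Lemma cexp_mx_mul v : cexp_mx *m v = wcol P' (cexp P' l' (unwcol P' v)).
Proof.
apply/matrixP => a j; rewrite (ord1 j) !mxE /cexp [in RHS]sum_enum_val mulr_sumr.
apply: eq_bigr => b _; rewrite !mxE [in RHS]rmorphM /= -[in RHS]mulrA sqrt_unwcol enum_valK.
by rewrite !rmorphM /=; ring.
Qed.

Lemma ap_unwcol_wcol F h : ap F (unwcol P' (wcol P' h)) =1 ap F h.
Proof.
apply: eq_ap => y; rewrite sqrt_unwcol mxE enum_rankK mulrA -rmorphM /= -expr2.
by rewrite sqr_sqrtr ?pmf_ge0.
Qed.

Lemma nrm2_mulmx_wcol F h :
  nrm2 (weighted_mx P P' F *m wcol P' h) = inner P (ap F h) (ap F h).
Proof.
rewrite weighted_mulmx nrm2_wcol; apply: eq_inner => x _; exact: ap_unwcol_wcol.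
Qed.

Lemma singular_value_residual_count f (t : R) : 0 <= t ->
  (#|[set j | (2 * t < singular_values (weighted_mx P P' (residual f)) 0 j)%R]| <=
   2 * #|[set j | (t < singular_values (weighted_mx P P' f) 0 j)%R]|)%N.
Proof.
move=> t0; apply: (@singular_value_count _ _ _ _ _ cexp_mx) => // v.
  by rewrite cexp_mx_mul nrm2_mulmx_wcol; apply: nrm2_residual.
rewrite cexp_mx_mul nrm2_wcol; apply: le_trans (cexp_contract _ _ _) _.
exact: inner_unwcol_le.
Qed.

(** Testing the form at h and at its image k gives |k|^2 <= N |h| |k|, an operator norm bound. *)
Lemma singular_value_residual_le f N j : 0 <= N ->
  reg_bound P P' l l' false f N -> singular_values (weighted_mx P P' (residual f)) 0 j <= N.
Proof.
move=> N0 H; apply: singular_value_le => // v.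
rewrite weighted_mulmx nrm2_wcol; set h := unwcol P' v; set k := ap _ h.
apply: (@le_trans _ _ (N ^+ 2 * inner P' h h)); last first.
  by rewrite ler_wpM2l ?sqr_ge0 ?inner_unwcol_le.
have k0 := inner_ge0 P k; have h0 := inner_ge0 P' h.
have [->|kn] := eqVneq (inner P k k) 0; first by rewrite mulr_ge0 ?sqr_ge0.
have k_gt0 : 0 < inner P k k by rewrite lt_neqAle eq_sym kn.
have kk : inner P k k = form P P' k (residual f) h by rewrite form_ap.
(* Rescaling asks for positive radii; if h were null, Cauchy-Schwarz would make k null too. *)
have h_gt0 : 0 < inner P' h h.
  rewrite lt_neqAle h0 andbT eq_sym; apply/negP => /eqP hz.
  have := inner_CS (prodp P P') (tens k h) (unc (residual f)).
  rewrite tens_norm hz mulr0 mul0r -/(form P P' k (residual f) h) -kk.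
  by rewrite leNgt exprn_gt0.
have := reg_boundZ (g := k) (h := h) (s := Num.sqrt (inner P k k)) (t := Num.sqrt (inner P' h h)) _ _ H.
rewrite !sqrtr_gt0 !sqr_sqrtr // /in_ball !lexx form_err_residual -kk => /(_ k_gt0 h_gt0 isT isT).
set s := Num.sqrt _; set t := Num.sqrt _.
have s_gt0 : 0 < s by rewrite sqrtr_gt0.
have -> : inner P k k = s ^+ 2 by rewrite sqr_sqrtr.
have -> : inner P' h h = t ^+ 2 by rewrite sqr_sqrtr.
rewrite -mulrA expr2 ler_pM2l // => st.
rewrite -expr2 -exprMn ler_pXn2r ?nnegrE ?mulr_ge0 ?sqrtr_ge0 //; last by rewrite mulrC.
Qed.

End Labels.
End Kernel.
End Operators.

(** * From codes to partitions *)

Section Partitions.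
Local Open Scope complex_scope.
Variable R : realType.

Section CodePartition.
Variables (X : finType) (c : code R X).

Definition code_partition : {set {set X}} := preim_partition (clabel c) [set: X].

Lemma code_partitionP : partition code_partition [set: X].
Proof. exact: preim_partitionP. Qed.

Lemma mem_pblock_code x y :
  (y \in pblock code_partition x) = (clabel c y == clabel c x).
Proof.
rewrite /code_partition /preim_partition pblock_equivalence_partition ?inE // 1?eq_sym //.
by split => // /eqP ->.
Qed.

Definition code_cell (j : clabel_type c) : {set X} := [set x | clabel c x == j].

Lemma big_code_partition (V : zmodType) (G : {set X} -> V) :
  \sum_(A in code_partition) G A = \sum_(j in [set clabel c x | x in X]) G (code_cell j).
Proof.
have -> : code_partition = code_cell @: [set clabel c x | x in X].
  apply/setP => A; apply/imsetP/imsetP.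
    move=> [x _ ->]; exists (clabel c x); first by apply: imset_f.
    by apply/setP => y; rewrite !inE eq_sym.
  move=> [_ /imsetP [x _ ->] ->]; exists x; first by rewrite inE.
  by apply/setP => y; rewrite !inE eq_sym.
rewrite big_imset // => _ _ /imsetP [x _ ->] /imsetP [y _ ->] /setP /(_ x).
by rewrite !inE eqxx => /esym /eqP.
Qed.

Lemma sum_cweight_le (J : {set clabel_type c}) : \sum_(j in J) cweight j <= 1.
Proof.
apply: le_trans (cweight_sum c); rewrite [leRHS](bigID (mem J)) /= lerDl.
by apply: sumr_ge0 => j _; apply/ltW/cweight_gt0.
Qed.

Variable P : finprob R X.

Lemma sum_Pr_code_cell (G : clabel_type c -> R) :
  \sum_(j in [set clabel c x | x in X]) Pr P (code_cell j) * G j =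
  \sum_x P x * G (clabel c x).
Proof.
rewrite [RHS](partition_big (clabel c) (mem [set clabel c x | x in X])) /=; last first.
  by move=> x _; apply: imset_f.
apply: eq_bigr => j _; rewrite /Pr mulr_suml.
by apply: eq_big => x; rewrite inE // => /eqP ->.
Qed.

(* Gibbs' inequality, from ln x <= x - 1. *)
Lemma entropy_code_le (s : R) : cost_le false P c s -> entropy P code_partition <= s.
Proof.
rewrite /cost_le => H; apply: le_trans H; rewrite /entropy big_code_partition /clen.
rewrite -(sum_Pr_code_cell (fun j => - ln (cweight j))).
rewrite -subr_ge0 -sumrB.
pose J := [set clabel c x | x in X].
(* The cell probabilities sum to 1 and the weights to at most 1, so a termwise lower bound by p - w
   is enough. *)
apply: (@le_trans _ _ (\sum_(j in J) (Pr P (code_cell j) - cweight j))).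
  rewrite sumrB subr_ge0; apply: le_trans (sum_cweight_le J) _.
  have <- := pmf_sum1 P.
  have -> : \sum_x P x = \sum_x P x * 1 by apply: eq_bigr => x _; rewrite mulr1.
  rewrite -(sum_Pr_code_cell (fun=> 1)) le_eqVlt; apply/orP; left; apply/eqP.
  by apply: eq_bigr => j _; rewrite mulr1.
apply: ler_sum => j _; set p := Pr _ _; set w := cweight j.
have w0 : 0 < w by apply: cweight_gt0.
have p0 : 0 <= p by apply: sumr_ge0 => x _; apply: pmf_ge0.
have [->|pn] := eqVneq p 0; first by rewrite !mul0r subrr sub0r oppr_le0 ltW.
have p_gt0 : 0 < p by rewrite lt_neqAle eq_sym pn.
have := @le_ln1Dx R (w / p - 1).
have -> : 1 + (w / p - 1) = w / p by ring.
have wp : 0 < w / p by rewrite divr_gt0.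
rewrite lnM ?posrE ?invr_gt0 // => /(_ _) H.
have {}H : ln w + ln p^-1 <= w / p - 1 by apply: H; lra.
have := ler_wpM2l p0 H; have -> : p * (w / p - 1) = w - p by field.
lra.
Qed.

(** Each label in use has weight at least exp (- s), and the weights sum to at most 1. *)
Lemma ln_card_code_le (s : R) : 0 <= s -> cost_le true P c s ->
  ln (#|code_partition|%:R : R) <= s.
Proof.
move=> s0 H.
have [->|n0] := eqVneq #|code_partition| 0%N; first by rewrite ln0.
rewrite -(expRK s) ler_ln ?posrE ?expR_gt0 ?ltr0n ?lt0n //.
have -> : #|code_partition|%:R = \sum_(A in code_partition) (1 : R).
  by rewrite sumr_const.
rewrite big_code_partition.
apply: (@le_trans _ _ (\sum_(j in [set clabel c x | x in X]) sequences.expR s * cweight j)).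
  apply: ler_sum => _ /imsetP [x _ ->].
  rewrite -[cweight _]lnK ?posrE ?cweight_gt0 // -expRD -expR0 ler_expR.
  by have := H x; rewrite /clen; lra.
by rewrite -mulr_sumr ler_piMr ?expR_ge0 // sum_cweight_le.
Qed.

Lemma Pr_pblock_code x : Pr P (pblock code_partition x) = cell_weight P (clabel c) x.
Proof. by apply: eq_bigl => y; rewrite mem_pblock_code. Qed.

End CodePartition.

(** Holds at every point: on null parts both sides are 0, by 0^-1 = 0. *)
Lemma condexp_code (X Y : finType) (P : finprob R X) (P' : finprob R Y)
    (c : code R X) (c' : code R Y) (f : X -> Y -> R[i]) x y :
  condexp P P' f (code_partition c) (code_partition c') x y =
  kcexp P P' (clabel c) (clabel c') f x y.
Proof.
rewrite /condexp !Pr_pblock_code /expect2 /kcexp /bcexp /cexp.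
rewrite -(pair_big predT predT (fun x' y' => (cexp_ker (prodp P P')
  (pair_label (clabel c) (clabel c')) (x, y) (x', y') * (P x' * P' y'))%:C * f x' y')) /=.
rewrite mulr_suml; apply: eq_bigr => x' _; rewrite mulr_suml; apply: eq_bigr => y' _.
rewrite cexp_ker_pair /= /indicator !mem_pblock_code /cexp_ker.
rewrite -fmorphV invfM !rmorphM /=.
by case: eqP => _; case: eqP => _ /=; ring.
Qed.

Lemma weighted_condexp (X Y : finType) (P : finprob R X) (P' : finprob R Y)
    (c : code R X) (c' : code R Y) (f : X -> Y -> R[i]) :
  weighted_mx P P' (fun x y =>
     f x y - condexp P P' f (code_partition c) (code_partition c') x y) =
  weighted_mx P P' (residual P P' (clabel c) (clabel c') f).
Proof. by apply/matrixP => a b; rewrite !mxE condexp_code. Qed.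

Lemma normcE_dotc (z : R[i]) : ComplexField.Normc.normc z = Num.sqrt (dotc z z).
Proof. by case: z => a b; rewrite /dotc /= -!expr2. Qed.

Lemma box_norm_le (X Y : finType) (P : finprob R X) (P' : finprob R Y)
    (c : code R X) (c' : code R Y) (f : X -> Y -> R[i]) (N : R) : 0 <= N ->
  reg_bound P P' (clabel c) (clabel c') true f N ->
  box_norm P P' (fun x y =>
     f x y - condexp P P' f (code_partition c) (code_partition c') x y) <= N.
Proof.
move=> N0 H; apply: bigmax_le => // A _; apply: bigmax_le => // B _.
set z := expect2 _ _ _; rewrite normcE_dotc.
have z0 := dotc_ge0 z.
have [->|zn] := eqVneq (dotc z z) 0; first by rewrite sqrtr0.
set s := Num.sqrt _.
have s2 : dotc z z = s ^+ 2 by rewrite sqr_sqrtr.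
have s_gt0 : 0 < s by rewrite sqrtr_gt0 lt_neqAle eq_sym zn.
have ind (Z : finType) (D : {set Z}) (u : R[i]) x : dotc u u <= 1 ->
    dotc (u * indicator R D x) (u * indicator R D x) <= 1.
  move=> u1; rewrite dotc_mul /indicator; case: (x \in D) => /=.
    by apply: le_trans u1; rewrite /dotc /=; lra.
  by rewrite dotc0l mulr0 ler01.
(* The phase z / |z|, placed in the first test function, makes the form equal to |z|. *)
have u1 : dotc ((s^-1)%:C * z) ((s^-1)%:C * z) <= 1.
  by rewrite dotcZl dotcZr s2 expr2 mulKf ?gt_eqF // mulVf ?gt_eqF.
have := H (fun x => (s^-1)%:C * z * indicator R A x) (fun y => indicator R B y).
rewrite form_err_residual => /(_ _ _) Hf.
have {Hf} : form P P' (fun x => (s^-1)%:C * z * indicator R A x)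
    (residual P P' (clabel c) (clabel c') f) (fun y => indicator R B y) <= N.
  apply: Hf; apply: in_ball_sup => x; first exact: ind.
  by have := @ind _ B 1 x; rewrite mul1r; apply; rewrite /dotc /=; lra.
have -> // : form P P' (fun x => (s^-1)%:C * z * indicator R A x)
    (residual P P' (clabel c) (clabel c') f) (fun y => indicator R B y) = s.
transitivity (dotc ((s^-1)%:C * z) z); last first.
  by rewrite dotcZl s2 expr2 mulKf ?gt_eqF.
move: ((s^-1)%:C * z) => u; rewrite form_sumE /z /expect2 dotc_sumr.
apply: eq_bigr => x _; rewrite dotc_sumr; apply: eq_bigr => y _.
rewrite dotcZr condexp_code -/(residual _ _ _ _ _ _ _); congr (_ * _).
move: u (residual _ _ _ _ _ _ _) => [a b] [d e]; rewrite /indicator.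
by case: (x \in A); case: (y \in B); rewrite /dotc /=; ring.
Qed.

End Partitions.

(** * Common partitions for a family of kernels *)

Section Families.
Local Open Scope complex_scope.
Variable R : realType.

(** The spaces vary with the index, so the code is transported along a = i; at other indices the
    trivial code costs nothing. *)
Lemma code_at (I : eqType) (X : I -> finType) (P : forall i, finprob R (X i)) b
    (a : I) (c : code R (X a)) (s : R) : 0 <= s -> cost_le b (P a) c s ->
  exists d : forall i, code R (X i), d a = c /\ forall i, cost_le b (P i) (d i) s.
Proof.
move=> s0 cs.
exists (fun i => if a =P i is ReflectT e then ecast i (code R (X i)) e c
                 else code_trivial R (X i)); split.
  by case: eqP => // e; rewrite eq_axiomK.
move=> i; case: eqP => [e|_]; first by case: _ / e.
by apply: cost_leW (cost_trivial _ _).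
Qed.

Definition refines (X : finType) (d c : code R X) :=
  forall x y, clabel d x = clabel d y -> clabel c x = clabel c y.

(** Several t may share an index; joining one t at a time, each index pays at most s per t. *)
Lemma code_family (I : eqType) (X : I -> finType) (P : forall i, finprob R (X i)) b
    (T : eqType) (a : T -> I) (c : forall t, code R (X (a t))) (s : R) (ts : seq T) :
  0 <= s -> (forall t, cost_le b (P (a t)) (c t) s) ->
  exists d : forall i, code R (X i),
    (forall i, cost_le b (P i) (d i) ((size ts)%:R * s)) /\
    (forall t, t \in ts -> refines (d (a t)) (c t)).
Proof.
move=> s0 cs; elim: ts => [|t ts [d [ds dr]]].
  exists (fun i => code_trivial R (X i)); split => // i.
  by rewrite mul0r; apply: cost_trivial.
have [e [ea es]] := code_at s0 (cs t).
exists (fun i => code_join (e i) (d i)); split => [i|u].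
  have -> : (size (t :: ts))%:R * s = s + (size ts)%:R * s.
    by rewrite /= -natr1; ring.
  exact: cost_join.
rewrite in_cons => /orP [/eqP ->|/dr du] x y H.
  by have := join_refine_l H; rewrite ea.
exact: du (join_refine_r H).
Qed.

(** Each space receives the join of all row and column codes, of cost 2 k s at most. Refining
    doubles errors, hence the precision delta / 2 and the factor 2^(2^(n+1)). *)
Lemma regularity_family (n : nat) : exists2 C : R, 0 <= C &
  forall (I : eqType) (X : I -> finType) (P : forall i, finprob R (X i))
    (k : nat) (i_ j_ : 'I_k -> I) (f : forall t : 'I_k, X (i_ t) -> X (j_ t) -> R[i])
    (b : bool) (M delta : R), 0 <= M -> 0 < delta <= 1 ->
  (forall t, schatten_pow (P (i_ t)) (P (j_ t)) (f t) n <= M ^+ (2 ^ n.+1)) ->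
  exists d : forall i, code R (X i),
    (forall i, cost_le b (P i) (d i) (k%:R * C * (delta ^+ (2 ^ n.+1))^-1)) /\
    (forall t, reg_bound (P (i_ t)) (P (j_ t)) (clabel (d (i_ t))) (clabel (d (j_ t)))
       b (f t) (delta * M)).
Proof.
have [C C0 HC] := regularity R n.
exists (2 * C * 2 ^+ (2 ^ n.+1)); first by rewrite !mulr_ge0 ?exprn_ge0.
move=> I X P k i_ j_ f b M delta M0 /andP[d0 d1] fM.
have d01 : 0 < delta / 2 <= 1 by apply/andP; split; lra.
set N := (2 ^ n.+1)%N in fM HC *.
pose s := C * ((delta / 2) ^+ N)^-1.
have s0 : 0 <= s by rewrite mulr_ge0 // invr_ge0 exprn_ge0 // divr_ge0 // ltW.
have sE : 2 * C * 2 ^+ N * (delta ^+ N)^-1 = s + s.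
  rewrite /s expr_div_n; have : delta ^+ N != 0 by rewrite expf_neq0 ?gt_eqF.
  have : 2 ^+ N != 0 :> R by rewrite expf_neq0 ?pnatr_eq0.
  by move: (delta ^+ N) (2 ^+ N) => u v v0 u0; field; rewrite u0 v0.
have cP t : {c : code R (X (i_ t)) * code R (X (j_ t)) |
    [/\ cost_le b (P (i_ t)) c.1 s, cost_le b (P (j_ t)) c.2 s &
    reg_bound (P (i_ t)) (P (j_ t)) (clabel c.1) (clabel c.2) b (f t) (delta / 2 * M)]}.
  by apply: cid; have [c [c' H]] := HC _ _ _ _ _ b _ _ M0 d01 (fM t); exists (c, c').
have [d [ds dr]] := @code_family I X P b _ i_ (fun t => (sval (cP t)).1) s (enum 'I_k) s0
  (fun t => let: And3 h _ _ := svalP (cP t) in h).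
have [e [es er]] := @code_family I X P b _ j_ (fun t => (sval (cP t)).2) s (enum 'I_k) s0
  (fun t => let: And3 _ h _ := svalP (cP t) in h).
exists (fun i => code_join (d i) (e i)); split => [i|t].
  have -> : k%:R * (2 * C * 2 ^+ N) * (delta ^+ N)^-1 =
      (size (enum 'I_k))%:R * s + (size (enum 'I_k))%:R * s.
    by rewrite -mulrA sE -cardE card_ord mulrDr.
  exact: cost_join.
have -> : delta * M = 2 * (delta / 2 * M) by field.
have [_ _ H] := svalP (cP t); apply: reg_bound_refine H => x y xy.
  by apply: (dr t); [rewrite mem_enum | apply: join_refine_l xy].
by apply: (er t); [rewrite mem_enum | apply: join_refine_r xy].
Qed.

End Families.

(** * Arithmetic of the exponents *)

Section Exponents.
Variable R : realType.

(** The maximum with 1 makes the exponent a successor n+1, matching an induction that starts at S^2;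
    the ceiling gives q <= 2^(n+1). *)
Lemma alpha_exponent (q : R) : 1 <= q -> exists n : nat,
  (2 : R) ^ Num.max (Num.ceil (ln q / ln 2)) 1 = (2 ^ n.+1)%:R /\ q <= (2 ^ n.+1)%:R.
Proof.
move=> q1; set z := Num.max _ _.
have z1 : 1 <= z by rewrite le_max lexx orbT.
have [n zn] : exists n : nat, z = n.+1%:Z.
  case: z z1 => [[|n]|n] // _; by exists n.
exists n; rewrite zn natrX; split => //.
have ln2 : 0 < ln (2 : R) by rewrite ln_gt0 // ltr1n.
rewrite -ler_ln ?posrE ?exprn_gt0 ?(lt_le_trans ltr01 q1) //.
rewrite lnXn // -[_ *+ n.+1]mulr_natl -ler_pdivrMr //.
apply: le_trans (ceil_ge _) _.
have : Num.ceil (ln q / ln 2) <= z by rewrite le_max lexx.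
by rewrite zn -(ler_int R).
Qed.

(** q / r is the reciprocal of the least r_t / q_t. The last clause reads r_t - q_t >= (1 - q / r)
    r_t, the gain that interpolation exploits. *)
Lemma div_exponent_lt1 (k : nat) (q_ : 'I_k -> R) (r_ : 'I_k -> \bar R) :
  (1 <= k)%N -> (forall t, 1 <= q_ t /\ ((q_ t)%:E < r_ t)%E) ->
  let q : R := \big[Num.max/0]_(t < k) q_ t in
  let r : \bar R :=
    (q%:E * \big[Order.min/+oo]_(t < k) (r_ t / (q_ t)%:E))%E in
  (0 <= fine (q%:E / r)%E < 1) /\
  (forall t rt, r_ t = rt%:E -> q_ t <= fine (q%:E / r)%E * rt).
Proof.
move=> k1 qr q r.
have q1 : 1 <= q.
  by apply: le_trans (qr (Ordinal k1)).1 _; apply: le_bigmax.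
pose rho := (\big[Order.min/+oo]_(t < k) (r_ t / (q_ t)%:E))%E.
have rdef : r = (q%:E * rho)%E by [].
have divE t rt : r_ t = rt%:E -> (r_ t / (q_ t)%:E = (rt / q_ t)%:E)%E.
  by move=> ->; rewrite inver gt_eqF // (lt_le_trans ltr01 (qr t).1).
have rho_gt1 : (1%:E < rho)%E.
  rewrite /rho; elim/big_ind: _ => [|x y x1 y1|t _]; first exact: ltry.
    by rewrite lt_min x1 y1.
  have [qt1 qrt] := qr t; have qt0 : 0 < q_ t by apply: lt_le_trans qt1.
  case rE: (r_ t) qrt => [rt||] //.
    rewrite lte_fin => qrt; have := divE t rt rE; rewrite rE => ->.
    by rewrite lte_fin ltr_pdivlMr // mul1r.
  by rewrite inver gt_eqF // gt0_mulye ?lte_fin ?invr_gt0 // !ltry.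
have rho_le t : (rho <= r_ t / (q_ t)%:E)%E by apply: bigmin_le.
have q0 : 0 < q by apply: lt_le_trans q1.
have qn : q != 0 by rewrite gt_eqF.
case rhoE: rho rho_gt1 rho_le => [s||] // rho_gt1 rho_le.
  have s1 : 1 < s by rewrite lte_fin in rho_gt1.
  have s0 : 0 < s by apply: lt_trans s1.
  have -> : fine (q%:E / r)%E = s^-1.
    rewrite rdef rhoE -EFinM inver mulf_eq0 (negPf qn) gt_eqF //= .
    by field; rewrite qn gt_eqF.
  split; first by rewrite invr_ge0 ltW //= invf_lt1.
  move=> t rt rE; have := rho_le t; rewrite (divE t rt rE) lee_fin.
  have qt0 : 0 < q_ t by apply: lt_le_trans (qr t).1.
  by rewrite ler_pdivlMr // => H; rewrite ler_pdivlMl.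
(* Here every r_t is infinite, so the last clause has no instance. *)
have -> : fine (q%:E / r)%E = 0.
  by rewrite rdef rhoE gt0_muley ?lte_fin // invey mule0.
split; first by rewrite lexx ltr01.
by move=> t rt rE; have := rho_le t; rewrite (divE t rt rE) leNgt ltry.
Qed.

End Exponents.

(** * From the operator norm to S^r *)

Section SchattenResidual.
Local Open Scope complex_scope.
Variable R : realType.
Variables (X Y : finType) (P : finprob R X) (P' : finprob R Y) (f : X -> Y -> R[i]).

Lemma schatten_pow_le (q M : R) (n : nat) : 1 <= q <= (2 ^ n.+1)%:R -> 0 <= M ->
  schatten_norm P P' q%:E f <= M -> schatten_pow P P' f n <= M ^+ (2 ^ n.+1).
Proof.
move=> /andP[q1 qn] M0 H; rewrite /schatten_pow trace_gram_exp -expnS.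
apply: (@sum_exprn_le _ _ _ _ q) H => // [j|]; first exact: singular_value_ge0.
by rewrite (lt_le_trans ltr01 q1).
Qed.

(** Interpolating between the S^q bound and s_j <= delta M leaves the factor 2 2^q delta^(r - q).
    Since 2 2^q <= 4^q <= 4^r, it is at most eps^r once delta^(r - q) <= (eps / 4)^r. *)
Lemma schatten_residual_le (L L' : eqType) (l : X -> L) (l' : Y -> L')
    (q M delta eps : R) (r : \bar R) :
  1 <= q -> (q%:E < r)%E -> 0 <= M -> 0 < delta <= eps ->
  (forall rt, r = rt%:E -> delta `^ (rt - q) <= (eps / 4) `^ rt) ->
  schatten_norm P P' q%:E f <= M ->
  reg_bound P P' l l' false f (delta * M) ->
  lnorm r (singular_values (weighted_mx P P' (residual P P' l l' f))) <= eps * M.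
Proof.
move=> q1 qr M0 /andP[d0 de] der fM H.
have q0 : 0 < q by apply: lt_le_trans q1.
have e0 : 0 < eps by apply: lt_le_trans de.
have dM : 0 <= delta * M by rewrite mulr_ge0 // ltW.
have eM : 0 <= eps * M by rewrite mulr_ge0 // ltW.
set s := singular_values _.
have s0 j : 0 <= s 0 j := singular_value_ge0 _ j.
have sd j : s 0 j <= delta * M by apply: singular_value_residual_le.
case: r qr der => [rt||] // qr der; last first.
  apply: bigmax_le => // j _; apply: le_trans (sd j) _; exact: ler_wpM2r.
rewrite lte_fin in qr.
have rt0 : 0 < rt by apply: lt_trans qr.
have Aq : \sum_j singular_values (weighted_mx P P' f) 0 j `^ q <= M `^ q.
  by rewrite -lnorm_leP // => j; apply: singular_value_ge0.
have Bq : \sum_j s 0 j `^ q <= 2 * 2 `^ q * M `^ q.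
  apply: le_trans (sum_powR_count q0 s0 _ _) _.
  - by move=> j; apply: (@singular_value_ge0 _ _ _ (weighted_mx P P' f) j).
  - by move=> t t0; apply: singular_value_residual_count.
  - by rewrite ler_wpM2l // mulr_ge0 ?powR_ge0.
rewrite lnorm_leP //.
apply: le_trans (sum_powR_interp s0 (p := rt) _ sd Bq) _; first by rewrite q0 ltW.
rewrite !powRM ?(ltW d0) ?(ltW e0) //.
have -> : 2 * 2 `^ q * M `^ q * (delta `^ (rt - q) * M `^ (rt - q)) =
    2 * 2 `^ q * delta `^ (rt - q) * M `^ rt.
  have -> : M `^ rt = M `^ q * M `^ (rt - q).
    by rewrite -powRD subrKC // gt_eqF.
  by ring.
rewrite ler_wpM2r ?powR_ge0 //.
apply: (@le_trans _ _ (4 `^ rt * (eps / 4) `^ rt)); last first.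
  rewrite -powRM ?divr_ge0 ?(ltW e0) //.
  by have -> : 4 * (eps / 4) = eps by field.
rewrite ler_pM ?mulr_ge0 ?powR_ge0 ?der //.
apply: (@le_trans _ _ (2 `^ q * 2 `^ q)).
  by rewrite ler_wpM2r ?powR_ge0 // le1r_powR // ler1n.
rewrite -powRM // -natrM; by apply: ler_powR; [rewrite ler1n | exact: ltW].
Qed.

End SchattenResidual.

Theorem theorem3p3 (R : realType) :
  exists (Ca : nat -> R -> R) (Cb : nat -> R -> \bar R -> R),
  forall (m : nat) (X : 'I_m -> finType) (P : forall i : 'I_m, finprob R (X i))
    (k : nat) (q_ : 'I_k -> R) (r_ : 'I_k -> \bar R) (i_ j_ : 'I_k -> 'I_m)
    (f : forall t : 'I_k, X (i_ t) -> X (j_ t) -> R[i]) (eps : R),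
  (1 <= k)%N ->
  (forall t : 'I_k, 1 <= q_ t /\ ((q_ t)%:E < r_ t)%E) ->
  0 < eps < 1 ->
  let q : R := \big[Num.max/0]_(t < k) q_ t in
  let r : \bar R :=
    (q%:E * \big[Order.min/+oo]_(t < k) (r_ t / (q_ t)%:E))%E in
  let M : R :=
    \big[Num.max/0]_(t < k)
      schatten_norm (P (i_ t)) (P (j_ t)) (q_ t)%:E (f t) in
  (exists Q : forall i : 'I_m, {set {set X i}},
    [/\ forall i : 'I_m, partition (Q i) [set: X i],
        \big[Num.max/0]_(i < m) ln (#|Q i|%:R : R)
          <= Ca k q * (1 / (eps `^ alpha q +oo%E)) &
        \big[Num.max/0]_(t < k)
          box_norm (P (i_ t)) (P (j_ t)) (fun x y =>
            f t x y
              - condexp (P (i_ t)) (P (j_ t)) (f t) (Q (i_ t)) (Q (j_ t)) x y)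
          <= eps * M]) /\
  (exists Q' : forall i : 'I_m, {set {set X i}},
    [/\ forall i : 'I_m, partition (Q' i) [set: X i],
        \big[Num.max/0]_(i < m) entropy (P i) (Q' i)
          <= Cb k q r * (1 / (eps `^ alpha q r)) &
        \big[Num.max/0]_(t < k)
          schatten_norm (P (i_ t)) (P (j_ t)) (r_ t) (fun x y =>
            f t x y
              - condexp (P (i_ t)) (P (j_ t)) (f t) (Q' (i_ t)) (Q' (j_ t)) x y)
          <= eps * M]).
Proof.
(* n is a function of q alone, fixed before the spaces and kernels, so that the constants do not
   depend on them; 0 is a filler for q < 1. *)
have /choice [n_ n_P] : forall q : R, exists n : nat, 1 <= q ->
    (2 : R) ^ Num.max (Num.ceil (ln q / ln 2)) 1 = (2 ^ n.+1)%:R /\ q <= (2 ^ n.+1)%:R.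
  move=> q; have [/alpha_exponent [n nP]|_] := leP 1 q; first by exists n.
  by exists 0%N.
pose C n := s2val (cid2 (regularity_family R n)).
have C0 n : 0 <= C n by rewrite /C; case: cid2.
have CP n := s2valP' (cid2 (regularity_family R n)).
exists (fun k q => k%:R * C (n_ q)).
exists (fun k q r => k%:R * C (n_ q) * 4 `^ alpha q r).
move=> m X P k q_ r_ i_ j_ f eps k1 qr /andP[e0 e1] q r M.
have q_le t : q_ t <= q by apply: le_bigmax.
have q1 : 1 <= q by apply: le_trans (qr (Ordinal k1)).1 (q_le _).
have M0 : 0 <= M by apply: bigmax_ge_id.
have fM t : schatten_norm (P (i_ t)) (P (j_ t)) (q_ t)%:E (f t) <= M.
  exact: (le_bigmax _ (fun t => schatten_norm (P (i_ t)) (P (j_ t)) (q_ t)%:E (f t))).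
have [two_pow qn] := n_P q q1; set n := n_ q in two_pow qn *.
have fM' t : schatten_pow (P (i_ t)) (P (j_ t)) (f t) n <= M ^+ (2 ^ n.+1).
  by apply: (schatten_pow_le _ M0 (fM t)); rewrite (qr t).1 (le_trans (q_le t)).
have [/andP[k0 k_lt1] qrt] := div_exponent_lt1 k1 qr.
have reg b delta := CP n 'I_m X P k i_ j_ f b M delta M0 ^~ fM'.
have eM : 0 <= eps * M by rewrite mulr_ge0 // ltW.
have kC : 0 <= k%:R * C n by rewrite mulr_ge0.
split.
  have [|d [dc dr]] := reg true eps; first by rewrite e0 ltW.
  exists (fun i => code_partition (d i)).
  have K0 : 0 <= k%:R * C n * (1 / eps `^ alpha q +oo%E).
    by rewrite mulr_ge0 // divr_ge0 ?powR_ge0.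
  split=> [i||].
  - exact: code_partitionP.
  - apply: bigmax_le => // i _; apply: ln_card_code_le => //.
    have -> : eps `^ alpha q +oo%E = eps ^+ (2 ^ n.+1).
      by rewrite /alpha two_pow invey mule0 subr0 divr1 powR_mulrn // ltW.
    by rewrite div1r.
  - by apply: bigmax_le => // t _; apply: box_norm_le (dr t).
set kap := 1 - fine (q%:E / r)%E.
have kap0 : 0 < kap by rewrite subr_gt0.
have kap1 : kap <= 1 by rewrite lerBlDr lerDl.
have e4 : 0 < eps / 4 by rewrite divr_gt0.
have e41 : 0 < eps / 4 <= 1 by rewrite e4 /=; clear - e0 e1; lra.
(* The power 1 / kap makes up for r_t - q_t being only kap r_t at worst. It turns the cost exponent
   2^(n+1) into [alpha q r], at precision eps / 4, whence 4^alpha in the constant. *)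
pose delta := (eps / 4) `^ kap^-1.
have d0 : 0 < delta by apply: powR_gt0.
have de : delta <= eps / 4 by apply: ge1r_powR => //; rewrite invf_ge1.
have de' : delta <= eps by apply: le_trans de _; clear - e0; lra.
have [|d [dc dr]] := reg false delta; first by rewrite d0 (le_trans de') // ltW.
exists (fun i => code_partition (d i)).
have K0 : 0 <= k%:R * C n * 4 `^ alpha q r * (1 / eps `^ alpha q r).
  by rewrite mulr_ge0 // ?divr_ge0 ?powR_ge0 // mulr_ge0 ?powR_ge0.
split=> [i||].
- exact: code_partitionP.
- apply: bigmax_le => // i _; apply: entropy_code_le.
  have -> : k%:R * C n * 4 `^ alpha q r * (1 / eps `^ alpha q r) =
      k%:R * C n * (delta ^+ (2 ^ n.+1))^-1; last exact: dc.
  have -> : delta ^+ (2 ^ n.+1) = (eps / 4) `^ alpha q r.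
    by rewrite /delta -powR_mulrn ?powR_ge0 // -powRrM /alpha two_pow -/kap; congr (_ `^ _); rewrite mulrC.
  have e_ne : eps `^ alpha q r != 0 by rewrite gt_eqF ?powR_gt0.
  have f_ne : (eps / 4) `^ alpha q r != 0 by rewrite gt_eqF ?powR_gt0.
  have : 4 `^ alpha q r * (eps / 4) `^ alpha q r = eps `^ alpha q r.
    rewrite -powRM ?(ltW e4) //.
    by have -> : 4 * (eps / 4) = eps by field.
  have key (u v w : R) : v != 0 -> w != 0 -> u * w = v ->
      k%:R * C n * u * (1 / v) = k%:R * C n * w^-1.
    move=> + w0 uw; rewrite -uw mulf_eq0 negb_or => /andP [u0 _].
    by field; rewrite u0 w0.
  exact: key.
apply: bigmax_le => // t _.
rewrite /schatten_norm weighted_condexp.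
apply: (schatten_residual_le (q := q_ t) (delta := delta)) (fM t) (dr t) => //.
- exact: (qr t).1.
- exact: (qr t).2.
- by rewrite d0.
(* As eps / 4 <= 1, the claim reduces to kap r_t <= r_t - q_t. *)
move=> rt rtE; rewrite /delta -powRrM; apply: ger_powR => //.
rewrite mulrC ler_pdivlMr // /kap.
by rewrite mulrBr mulr1 lerD2l lerN2 mulrC; apply: qrt.
Qed.
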